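(* Let $A\in\mathbb{R}^{m\times n}$, $b\in\mathbb{R}^m$, $\sigma\ge0$. Let integers $k\ge2$ and $r\ge0$ be given such that $k+r\le n-1$. Suppose that $x^*$ is an optimal solution of the problem $$\min_{x\in\mathbb{R}^n}\Big\{\sum_{i=r+1}^n|x|_{[i]}:\ \|Ax-b\|\le\sigma\Big\},$$ and that $\tilde x^*\in\mathbb{R}^n$ satisfies $\|A\tilde x^*-b\|\le\sigma$. Then: (i) If $\delta=\delta^A_{k+\lceil r/2\rceil}<\frac13$, then $$\|\tilde x^*-x^*\|\le\frac{2\sqrt{2(1+\delta)}\,\sigma}{1-3\delta}+\frac{2\sqrt2\,\big(2\delta+\sqrt{(1-3\delta)\delta}\big)}{1-3\delta}\cdot\frac{\|\tilde x^*_{-\max(k)}\|_1}{\sqrt{k+\lceil r/2\rceil}}.$$ (ii) If $\delta=\delta^A_{\gamma(k+\lceil r/2\rceil)}<\sqrt{(\gamma-1)/\gamma}$ for some $\gamma>1$, then $$\|\tilde x^*-x^*\|\le\frac{2\sqrt{2(1+\delta)}\,\sigma}{1-\sqrt{\gamma/(\gamma-1)}\,\delta}+\left(\frac{\sqrt2\,\delta+\sqrt{\gamma\big(\sqrt{(\gamma-1)/\gamma}-\delta\big)\delta}}{\gamma\big(\sqrt{(\gamma-1)/\gamma}-\delta\big)}+1\right)\frac{2\|\tilde x^*_{-\max(k)}\|_1}{\sqrt{k+\lceil r/2\rceil}}.$$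
   Context: $\|\cdot\|$ is the Euclidean norm and $\|\cdot\|_1$ the $\ell_1$ norm. $|x|_{[i]}$ denotes the $i$th largest element of $\{|x_1|,\ldots,|x_n|\}$ (counted with multiplicity). $x_{-\max(k)}$ is the vector obtained from $x$ by replacing the $k$ entries of largest absolute value by zero. $x$ is $k$-sparse if it has at most $k$ nonzero entries. For an integer $1\le k\le n$, the restricted isometry constant $\delta^A_k$ is the smallest number $\delta$ such that $(1-\delta)\|x\|^2\le\|Ax\|^2\le(1+\delta)\|x\|^2$ for all $k$-sparse $x\in\mathbb{R}^n$; for non-integer $k>0$, $\delta^A_k:=\delta^A_{\lceil k\rceil}$. Whenever $\delta^A_k$ is used, it is understood that $1\le\lceil k\rceil\le n$. *)

(* Defs.v *)
From mathcomp Require Import all_boot all_order all_algebra.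
From mathcomp Require Import classical_sets reals.
Set Implicit Arguments.
Unset Strict Implicit.
Unset Printing Implicit Defensive.
Import Order.TTheory GRing.Theory Num.Theory.
Local Open Scope classical_set_scope.
Local Open Scope ring_scope.

(* MathComp-Analysis puts the sup norm on matrices, hence the explicit norms. *)
Definition norm2 (R : realType) (n : nat) (x : 'cV[R]_n) : R :=
  Num.sqrt (\sum_i x i 0 ^+ 2).

Definition norm1 (R : realType) (n : nat) (x : 'cV[R]_n) : R :=
  \sum_i `|x i 0|.

(* [sorted_abs x i] is |x|_[i], the i-th largest absolute value, 1 <= i <= n. *)
Definition sorted_abs (R : realType) (n : nat) (x : 'cV[R]_n) (i : nat) : R :=
  nth 0 (sort >=%R [seq `|x j 0| | j <- enum 'I_n]) i.-1.

(* The indices by decreasing absolute value of the entry; [sort] is stable,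
   so ties are broken in favour of the smaller index. *)
Definition index_by_abs (R : realType) (n : nat) (x : 'cV[R]_n) : seq 'I_n :=
  sort (fun i j : 'I_n => `|x j 0| <= `|x i 0|) (enum 'I_n).

(* x_{-max(k)} *)
Definition minus_max (R : realType) (n k : nat) (x : 'cV[R]_n) : 'cV[R]_n :=
  \col_i (if i \in take k (index_by_abs x) then 0 else x i 0).

Definition sparse (R : realType) (n k : nat) (x : 'cV[R]_n) : bool :=
  (#|[pred i | x i 0%R != 0%R]| <= k)%N.

Definition rip (R : realType) (m n : nat) (A : 'M[R]_(m, n)) (k : nat)
    (delta : R) : Prop :=
  forall x : 'cV[R]_n, sparse k x ->
    (1 - delta) * norm2 x ^+ 2 <= norm2 (A *m x) ^+ 2
      <= (1 + delta) * norm2 x ^+ 2.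

(* The infimum is a minimum as soon as 1 <= k <= n: see [ric_smallest]. *)
Definition ric (R : realType) (m n : nat) (A : 'M[R]_(m, n)) (k : nat) : R :=
  inf [set delta | rip A k delta].

(* The restricted isometry constant of real order t > 0. *)
Definition ric_real (R : realType) (m n : nat) (A : 'M[R]_(m, n)) (t : R) : R :=
  ric A `|Num.ceil t|%N.

Definition feasible (R : realType) (m n : nat) (A : 'M[R]_(m, n))
    (b : 'cV[R]_m) (sigma : R) : set 'cV[R]_n :=
  [set x | norm2 (A *m x - b) <= sigma].

Definition partial_norm1 (R : realType) (n r : nat) (x : 'cV[R]_n) : R :=
  \sum_(r.+1 <= i < n.+1) sorted_abs x i.

Definition minimizer (R : realType) (T : Type) (f : T -> R) (C : set T) (x : T)
    : Prop :=
  C x /\ forall y, C y -> f x <= f y.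

Lemma norm2_sqr (R : realType) (n : nat) (x : 'cV[R]_n) :
  norm2 x ^+ 2 = \sum_i x i 0 ^+ 2.
Proof. by rewrite sqr_sqrtr // sumr_ge0 // => i _; exact: sqr_ge0. Qed.

Lemma norm2_mulmx_bound (R : realType) (m n : nat) (A : 'M[R]_(m, n)) :
  exists2 c : R, 0 <= c &
    forall x : 'cV[R]_n, norm2 (A *m x) ^+ 2 <= c * norm2 x ^+ 2.
Proof.
exists (\sum_i (\sum_j `|A i j|) ^+ 2) => [|x].
  by apply: sumr_ge0 => i _; exact: sqr_ge0.
rewrite norm2_sqr mulr_suml; apply: ler_sum => i _.
rewrite -exprMn -[leLHS]real_normK ?num_real// ler_pXn2r ?nnegrE//.
  rewrite mxE mulr_suml (le_trans (ler_norm_sum _ _ _))//.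
  apply: ler_sum => j _; rewrite normrM ler_wpM2l//.
  rewrite -sqrtr_sqr ler_sqrt; last first.
    by apply: sumr_ge0 => l _; exact: sqr_ge0.
  by rewrite (bigD1 j)//= lerDl sumr_ge0// => l _; exact: sqr_ge0.
by rewrite mulr_ge0 ?sqrtr_ge0// sumr_ge0.
Qed.

Lemma ric_smallest (R : realType) (m n : nat) (A : 'M[R]_(m, n)) (k : nat) :
  (0 < k <= n)%N ->
  rip A k (ric A k) /\ forall delta, rip A k delta -> ric A k <= delta.
Proof.
move=> /andP[k0 kn].
have [c c0 cA] := norm2_mulmx_bound A.
have n0 : (0 < n)%N by exact: leq_trans kn.
have ripge0 d : rip A k d -> 0 <= d.
  pose e : 'cV[R]_n := delta_mx (Ordinal n0) 0.
  have eE i : e i 0 = (i == Ordinal n0)%:R by rewrite mxE eqxx andbT.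
  have ek : sparse k e.
    apply: leq_trans k0; apply: leq_trans (eq_leq (card1 (Ordinal n0))).
    apply: subset_leq_card.
    apply/fintype.subsetP => i; rewrite !inE.
    by apply: contraNT => /negPf ni; rewrite eE ni.
  have e1 : norm2 e ^+ 2 = 1.
    rewrite norm2_sqr (bigD1 (Ordinal n0))//= eE eqxx expr1n big1 ?addr0//.
    by move=> i /negPf ni; rewrite eE ni expr0n.
  move=> /(_ e ek); rewrite e1 !mulr1 => /andP[/le_trans h /h].
  by rewrite lerD2l -subr_ge0 opprK -mulr2n pmulrn_lge0.
have ne : [set d | rip A k d] !=set0.
  exists (1 + c) => x _; apply/andP; split.
    apply: (@le_trans _ _ 0); last exact: sqr_ge0.
    by rewrite opprD addrA subrr add0r mulNr oppr_le0 mulr_ge0// sqr_ge0.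
  apply: le_trans (cA x) _; rewrite ler_wpM2r ?sqr_ge0//.
  by rewrite addrA lerDr addr_ge0.
have lb0 : has_lbound [set d | rip A k d] by exists 0 => d /ripge0.
split; last by move=> d hd; exact: ge_inf.
move=> x xk; have [x0|] := eqVneq (norm2 x ^+ 2) 0.
  rewrite x0 !mulr0 sqr_ge0 /=.
  by have := cA x; rewrite x0 mulr0.
move=> xn0; have x0 : 0 < norm2 x ^+ 2 by rewrite lt0r xn0 sqr_ge0.
apply/andP; split.
  rewrite -ler_pdivlMr// lerBlDr -lerBlDl; apply: lb_le_inf => // d.
  by move=> /(_ x xk)/andP[+ _]; rewrite -ler_pdivlMr// lerBlDr -lerBlDl.
rewrite -ler_pdivrMr// -lerBlDl; apply: lb_le_inf => // d.
by move=> /(_ x xk)/andP[_]; rewrite -ler_pdivrMr// -lerBlDl.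
Qed.

(* Main.v *)
Require Import Defs.
From mathcomp Require Import all_boot all_order all_algebra.
From mathcomp Require Import classical_sets reals.
From mathcomp Require Import zify ring lra.
Import Order.TTheory GRing.Theory Num.Theory.
Local Open Scope ring_scope.

(** Let h be the difference of the two vectors, K = k + ceil(r/2), T the set of
    the K largest entries of |h|, w = h restricted to T, Y = |w|,
    rho = |xt_{-max(k)}|_1 and P = 2 rho / sqrt K.

    Optimality for the partial l1 norm enters only through a cone condition
    ([partial_norm1_cone]): the entries of h outside T have total mass at most
    that of the entries in T plus 2 rho.  It holds because a partial l1 norm is
    the least l1 mass left after deleting r entries, so one may delete from
    both vectors the r largest entries of the optimal one; the half-integer
    shift appears because the sets of exceptional indices, of sizes at most
    k + r and k, are compared together with two copies of T.  Feasibility of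
    both vectors gives |A h| <= 2 sigma.

    From there on everything is about the symmetric bilinear form
    B(x, y) = <A x, A y> - <x, y> ([defect]).  The restricted isometry property
    says that |B(x, x)| <= delta |x|^2 for sparse x, so by polarisation
    B(x, y) >= - delta/2 (|x|^2 + |y|^2) when x and y live on a common small
    support ([rip_bilinear]).  To use it with the non-sparse tail of h, note
    that only B(w, .), a linear form, is applied to the tail: on the polytope
    of vectors with bounded sup norm and l1 norm a linear form is minimal at a
    sparse vector with constant modulus ([sparse_linear_min]), and that vector
    replaces the tail.  A lower bound for B(w, h) bounds Y, because
    Y^2 + B(w, h) = <A w, A h> <= 2 sigma sqrt(1 + delta) Y, and a bound for Y
    bounds |h| by the cone condition ([tail_estimates]).

    For part (ii) the order gamma K leaves room beside w for a sparse vector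
    of (gamma - 1) K entries; the few tail entries that exceed the sup norm
    bound are moved from the tail to w ([enlarged_head_defect_lower]).

    For part (i) there is no room, and w itself has to be cut in two halves.
    Averaging over cyclic windows of T and using the halves with opposite signs
    cancels the unknown diagonal terms, also when K is odd and the halves are
    unequal ([balanced_split_bound], [head_defect_lower]).  The resulting bound
    on Y and the cone condition suffice when delta is not small.  For small
    delta they lose a multiple of sigma P, and a second inequality is used:
    |A x|^2 >= (1 - delta) |x|^2 - 2 delta |x|_1^2 / K for every x
    ([rip_lower_l1]), which expresses x as the mean of K independent random
    one-sparse vectors.  The two regimes are joined in
    [recovery_bound_third]. *)

Set Implicit Arguments.
Unset Strict Implicit.
Unset Printing Implicit Defensive.

(** * Inner product, restriction and the defect form *)

Definition dot (R : realType) (n : nat) (x y : 'cV[R]_n) : R :=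
  \sum_i x i 0 * y i 0.

Definition restr (R : realType) (n : nat) (S : {set 'I_n}) (x : 'cV[R]_n) :
  'cV[R]_n := \col_i (if i \in S then x i 0 else 0).

Definition supported (R : realType) (n : nat) (S : {set 'I_n})
  (x : 'cV[R]_n) : Prop := forall i, i \notin S -> x i 0 = 0.

(** The symmetric bilinear form of A^T A - 1, which measures how far A is from
    an isometry. *)
Definition defect (R : realType) (m n : nat) (A : 'M[R]_(m, n))
  (x y : 'cV[R]_n) : R := dot (A *m x) (A *m y) - dot x y.

Section Dot.
Context (R : realType).
Implicit Types (n : nat).

Lemma dotC n (x y : 'cV[R]_n) : dot x y = dot y x.
Proof. by apply: eq_bigr => i _; rewrite mulrC. Qed.

Lemma dotDl n (x y z : 'cV[R]_n) : dot (x + y) z = dot x z + dot y z.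
Proof. by rewrite /dot -big_split; apply: eq_bigr => i _; rewrite mxE mulrDl. Qed.

Lemma dotZl n a (x y : 'cV[R]_n) : dot (a *: x) y = a * dot x y.
Proof. by rewrite /dot mulr_sumr; apply: eq_bigr => i _; rewrite mxE mulrA. Qed.

Lemma dot_suml n I (s : seq I) (F : I -> 'cV[R]_n) y :
  dot (\sum_(i <- s) F i) y = \sum_(i <- s) dot (F i) y.
Proof.
elim: s => [|i s IH]; last by rewrite !big_cons dotDl IH.
by rewrite !big_nil -(scale0r 0) dotZl mul0r.
Qed.

Lemma dot_ge0 n (x : 'cV[R]_n) : 0 <= dot x x.
Proof. by apply: sumr_ge0 => i _; rewrite -expr2 sqr_ge0. Qed.

Lemma norm2_sqr_dot n (x : 'cV[R]_n) : norm2 x ^+ 2 = dot x x.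
Proof. by rewrite norm2_sqr; apply: eq_bigr => i _; rewrite expr2. Qed.

Lemma norm2_ge0 n (x : 'cV[R]_n) : 0 <= norm2 x.
Proof. exact: sqrtr_ge0. Qed.

Lemma norm2_sqrD n a b (x y : 'cV[R]_n) :
  norm2 (a *: x + b *: y) ^+ 2 =
    a ^+ 2 * norm2 x ^+ 2 + 2 * a * b * dot x y + b ^+ 2 * norm2 y ^+ 2.
Proof.
rewrite !norm2_sqr_dot dotDl !dotZl ![dot _ (_ + _)]dotC !dotDl !dotZl.
by rewrite (dotC y x); ring.
Qed.

Lemma cauchy_schwarz n (x y : 'cV[R]_n) : dot x y <= norm2 x * norm2 y.
Proof.
have [y0|y0] := eqVneq (norm2 y) 0.
  have /psumr_eq0P yi : dot y y = 0 by rewrite -norm2_sqr_dot y0 expr0n.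
  rewrite y0 mulr0 /dot big1// => i _.
  have /eqP := yi (fun i _ => @sqr_ge0 _ (y i 0)) i isT.
  by rewrite mulf_eq0 orbb => /eqP ->; rewrite mulr0.
have y1 : 0 < norm2 y by rewrite lt0r y0 norm2_ge0.
have h := sqr_ge0 (norm2 (norm2 y *: x + (- norm2 x) *: y)).
rewrite norm2_sqrD in h.
have [x0|x0] := eqVneq (norm2 x) 0.
  have /psumr_eq0P xi : dot x x = 0 by rewrite -norm2_sqr_dot x0 expr0n.
  rewrite x0 mul0r /dot big1// => i _.
  have /eqP := xi (fun i _ => @sqr_ge0 _ (x i 0)) i isT.
  by rewrite mulf_eq0 orbb => /eqP ->; rewrite mul0r.
have x1 : 0 < norm2 x by rewrite lt0r x0 norm2_ge0.
have xy : 0 < norm2 x * norm2 y by rewrite mulr_gt0.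
rewrite -(ler_pM2l xy); nra.
Qed.

Lemma restrE n S (x : 'cV[R]_n) i :
  restr S x i 0 = if i \in S then x i 0 else 0.
Proof. by rewrite mxE. Qed.

Lemma restr_supported n S (x : 'cV[R]_n) : supported S (restr S x).
Proof. by move=> i /negPf iS; rewrite restrE iS. Qed.

Lemma supportedW n (S S' : {set 'I_n}) (x : 'cV[R]_n) :
  S \subset S' -> supported S x -> supported S' x.
Proof. by move=> /fintype.subsetP sS xS i iS'; apply: xS; apply: contra iS'; exact: sS. Qed.

Lemma supportedD n (S : {set 'I_n}) (x y : 'cV[R]_n) :
  supported S x -> supported S y -> supported S (x + y).
Proof. by move=> xS yS i iS; rewrite mxE xS// yS// addr0. Qed.

Lemma supportedZ n (S : {set 'I_n}) a (x : 'cV[R]_n) :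
  supported S x -> supported S (a *: x).
Proof. by move=> xS i iS; rewrite mxE xS// mulr0. Qed.

Lemma supported_sparse n k (S : {set 'I_n}) (x : 'cV[R]_n) :
  supported S x -> (#|S| <= k)%N -> sparse k x.
Proof.
move=> xS; apply: leq_trans; apply/subset_leq_card/fintype.subsetP => i.
by rewrite inE; apply: contraR => /xS ->.
Qed.

Lemma dot_restr n S (x y : 'cV[R]_n) :
  dot (restr S x) y = \sum_(i in S) x i 0 * y i 0.
Proof.
rewrite /dot [RHS]big_mkcond; apply: eq_bigr => i _.
by rewrite restrE; case: ifP => // _; rewrite mul0r.
Qed.

Lemma norm2_restr n S (x : 'cV[R]_n) :
  norm2 (restr S x) ^+ 2 = \sum_(i in S) x i 0 ^+ 2.
Proof.
rewrite norm2_sqr_dot dot_restr; apply: eq_bigr => i iS.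
by rewrite restrE iS expr2.
Qed.

Lemma restr_setC n S (x : 'cV[R]_n) : restr S x + restr (~: S) x = x.
Proof.
apply/matrixP => i j; rewrite ord1 mxE !restrE inE.
by case: ifP => _; rewrite ?addr0 ?add0r.
Qed.

Lemma dot_disjoint n (S : {set 'I_n}) (x y : 'cV[R]_n) :
  supported S x -> supported (~: S) y -> dot x y = 0.
Proof.
move=> xS yS; rewrite /dot big1// => i _; have [iS|iS] := boolP (i \in S).
  by rewrite yS ?mulr0// inE iS.
by rewrite xS ?mul0r.
Qed.

End Dot.

Section Defect.
Context (R : realType) (m n : nat) (A : 'M[R]_(m, n)).
Implicit Types (x y z : 'cV[R]_n).

Lemma defectC x y : defect A x y = defect A y x.
Proof. by rewrite /defect dotC (dotC x). Qed.

Lemma defectDl x y z : defect A (x + y) z = defect A x z + defect A y z.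
Proof. by rewrite /defect mulmxDr !dotDl; ring. Qed.

Lemma defectZl a x y : defect A (a *: x) y = a * defect A x y.
Proof. by rewrite /defect -scalemxAr !dotZl; ring. Qed.

Lemma defectDr x y z : defect A x (y + z) = defect A x y + defect A x z.
Proof. by rewrite defectC defectDl !(defectC x). Qed.

Lemma defectZr a x y : defect A x (a *: y) = a * defect A x y.
Proof. by rewrite defectC defectZl (defectC x). Qed.

Lemma defect_suml I (s : seq I) (F : I -> 'cV[R]_n) y :
  defect A (\sum_(i <- s) F i) y = \sum_(i <- s) defect A (F i) y.
Proof. by rewrite /defect mulmx_sumr !dot_suml sumrB. Qed.

Lemma defectE x y : defect A x y = dot (A^T *m (A *m x) - x) y.
Proof.
rewrite /defect dotDl -[in RHS]scaleN1r dotZl mulN1r; congr (_ - _).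
rewrite /dot.
under eq_bigr do rewrite [(A *m y) _ _]mxE mulr_sumr.
rewrite exchange_big; apply: eq_bigr => j _ /=.
rewrite mxE mulr_suml; apply: eq_bigr => i _.
by rewrite [A^T _ _]mxE; ring.
Qed.

Lemma defect_diag x : defect A x x = norm2 (A *m x) ^+ 2 - norm2 x ^+ 2.
Proof. by rewrite /defect !norm2_sqr_dot. Qed.

Lemma rip_defect k delta S x : rip A k delta -> supported S x ->
  (#|S| <= k)%N -> `|defect A x x| <= delta * norm2 x ^+ 2.
Proof.
move=> ripA xS Sk; have /andP[l u] := ripA x (supported_sparse xS Sk).
by rewrite defect_diag ler_norml; apply/andP; split; lra.
Qed.

(** Polarisation.  The arithmetic mean of the squared norms, rather than the
    product of the norms, is what survives averaging over many pairs x, y. *)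
Lemma rip_bilinear k delta S x y : rip A k delta ->
  supported S x -> supported S y -> (#|S| <= k)%N ->
  - (delta / 2) * (norm2 x ^+ 2 + norm2 y ^+ 2) <= defect A x y.
Proof.
move=> ripA xS yS Sk.
have := rip_defect ripA (supportedD xS yS) Sk.
have := rip_defect ripA (supportedD xS (supportedZ (-1) yS)) Sk.
rewrite !ler_norml => /andP[_ h1] /andP[h2 _].
move: h1 h2; rewrite !norm2_sqr_dot !(defectDl, defectDr, defectZl, defectZr).
rewrite !dotDl !dotZl ![dot _ (_ + _)]dotC !dotDl !dotZl (defectC y x) (dotC y x).
by move=> h1 h2; lra.
Qed.

(** Tested on one basis vector. *)
Lemma rip_ge0 k delta : rip A k delta -> (0 < k)%N -> (0 < n)%N -> 0 <= delta.
Proof.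
move=> ripA k0 n0; pose i := Ordinal n0; pose e : 'cV[R]_n := delta_mx i 0.
have eS : supported [set i] e.
  by move=> j; rewrite inE mxE => /negPf ->.
have := rip_defect ripA eS; rewrite cards1 => /(_ k0).
have -> : norm2 e ^+ 2 = 1.
  rewrite norm2_sqr (bigD1 i)//= mxE !eqxx expr1n big1 ?addr0// => j /negPf ji.
  by rewrite mxE ji expr0n.
by rewrite mulr1; apply: le_trans.
Qed.

End Defect.

(** * Largest entries, the partial norm and linear forms *)

Definition topset (R : realType) (n k : nat) (x : 'cV[R]_n) : {set 'I_n} :=
  [set i in take k (index_by_abs x)].

Section TopSet.
Context (R : realType) (n : nat).
Implicit Types (x v c h : 'cV[R]_n) (S T U : {set 'I_n}).

Lemma perm_index_by_abs x : perm_eq (index_by_abs x) (enum 'I_n).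
Proof. by rewrite perm_sort. Qed.

Lemma uniq_index_by_abs x : uniq (index_by_abs x).
Proof. by rewrite sort_uniq enum_uniq. Qed.

Lemma size_index_by_abs x : size (index_by_abs x) = n.
Proof. by rewrite size_sort size_enum_ord. Qed.

Lemma card_topset_min k x : #|topset k x| = minn k n.
Proof.
rewrite cardsE; have /card_uniqP -> := take_uniq k (uniq_index_by_abs x).
by rewrite size_take_min size_index_by_abs.
Qed.

Lemma card_topset k x : (k <= n)%N -> #|topset k x| = k.
Proof. by move=> kn; rewrite card_topset_min; apply/minn_idPl. Qed.

Lemma mem_drop_index k x i :
  (i \in drop k (index_by_abs x)) = (i \notin topset k x).
Proof.
have := uniq_index_by_abs x; rewrite -{1}(cat_take_drop k (index_by_abs x)).
rewrite cat_uniq => /and3P[_ /hasPn disj _].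
have : i \in index_by_abs x.
  by rewrite (perm_mem (perm_index_by_abs x)) mem_enum.
rewrite -{1}(cat_take_drop k (index_by_abs x)) mem_cat inE.
have [/disj /= /negPf ->//|] := boolP (i \in drop k _).
by rewrite orbF => _ ->.
Qed.

Lemma sum_notin_topset k x (F : 'I_n -> R) :
  \sum_(i | i \notin topset k x) F i =
  \sum_(i <- drop k (index_by_abs x)) F i.
Proof.
rewrite big_uniq /=; last exact/drop_uniq/uniq_index_by_abs.
by apply: eq_bigl => i; rewrite mem_drop_index.
Qed.

(** All the optimality properties of the k largest entries follow from the
    existence of a separating level t. *)
Lemma topset_threshold k x : exists t : R, [/\ 0 <= t,
  forall i, i \in topset k x -> t <= `|x i 0| &
  forall i, i \notin topset k x -> `|x i 0| <= t].
Proof.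
pose leA := fun i j : 'I_n => `|x j 0| <= `|x i 0|.
have trA : transitive leA by move=> j i l /= ij jl; exact: le_trans jl ij.
have toA : total leA by move=> i j; rewrite /leA; exact: le_total.
have : pairwise leA (index_by_abs x).
  by rewrite -sorted_pairwise//; exact: sort_sorted.
rewrite -{1}(cat_take_drop k (index_by_abs x)) pairwise_cat.
move=> /and3P[/allrelP hAB _ hB].
case E : (drop k (index_by_abs x)) => [|j s].
  exists 0; split=> // i; rewrite -mem_drop_index E//.
exists `|x j 0|; split=> // i.
  by rewrite inE => iT; apply: hAB => //; rewrite E mem_head.
rewrite -mem_drop_index E inE => /predU1P[->//|is_].
by move: hB; rewrite E /= => /andP[/allP/(_ i is_)].
Qed.

Lemma partial_norm1E r x :
  partial_norm1 r x = \sum_(i | i \notin topset r x) `|x i 0|.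
Proof.
rewrite sum_notin_topset /partial_norm1 /sorted_abs sort_map.
rewrite -[sort _ (enum _)]/(index_by_abs x).
rewrite big_add1 /=.
under eq_bigr do rewrite /=.
rewrite -(big_map (fun i => `|x i 0|) xpredT id) map_drop.
rewrite [RHS](big_nth 0) size_drop size_map size_index_by_abs.
rewrite -[X in index_iota X n]add0n big_addn; apply: eq_bigr => i _.
by rewrite nth_drop addnC.
Qed.

Lemma norm1_minus_max k x :
  norm1 (minus_max k x) = \sum_(i | i \notin topset k x) `|x i 0|.
Proof.
rewrite /norm1 [RHS]big_mkcond; apply: eq_bigr => i _; rewrite mxE inE.
by case: ifP => //=; rewrite normr0.
Qed.

(** The sum of g - t over any set is at most its sum over T, which contains
    every nonnegative term and only such terms. *)
Lemma threshold_sum (g : 'I_n -> R) t T U :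
  (forall i, i \in T -> t <= g i) -> (forall i, i \notin T -> g i <= t) ->
  \sum_(i in U) g i <= \sum_(i in T) g i + t * (#|U|%:R - #|T|%:R).
Proof.
move=> gT gC.
have sumt (V : {set 'I_n}) : \sum_(i in V) (g i - t) = \sum_(i in V) g i - t * #|V|%:R.
  by rewrite sumrB sumr_const mulr_natr.
suff : \sum_(i in U) (g i - t) <= \sum_(i in T) (g i - t).
  by rewrite !sumt; lra.
rewrite big_mkcond [leRHS]big_mkcond; apply: ler_sum => i _.
case: ifP => [_|_]; case: ifP => iT //; rewrite ?subr_ge0 ?subr_le0//.
  by apply: gC; rewrite iT.
exact: gT.
Qed.

Lemma partial_norm1_le r x S : (r <= n)%N -> (#|S| <= r)%N ->
  partial_norm1 r x <= \sum_(i | i \notin S) `|x i 0|.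
Proof.
move=> rn Sr; rewrite partial_norm1E.
have [t [t0 tT tC]] := topset_threshold r x.
have := threshold_sum S tT tC; rewrite card_topset//.
have : t * (#|S|%:R - r%:R) <= 0.
  by rewrite mulr_ge0_le0// subr_le0 ler_nat.
have E (V : {set 'I_n}) : \sum_i `|x i 0| =
    \sum_(i in V) `|x i 0| + \sum_(i | i \notin V) `|x i 0|.
  by rewrite (bigID [in V]).
by have := E S; have := E (topset r x); lra.
Qed.

(** The polytope of vectors v with |v_i| <= a and |v|_1 <= s a is the convex
    hull of s-sparse vectors with entries at most a; this is the dual form of
    that fact.  The minimiser puts the values a and -a against the s largest
    coefficients of the linear form. *)
Lemma sparse_linear_min c v (D : {set 'I_n}) (s : nat) (a : R) :
  0 <= a -> supported D v -> (forall i, `|v i 0| <= a) ->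
  \sum_i `|v i 0| <= s%:R * a -> (s <= n)%N ->
  exists u (S : {set 'I_n}), [/\ S \subset D, (#|S| <= s)%N, supported S u,
    norm2 u ^+ 2 <= s%:R * a ^+ 2 & dot c u <= dot c v].
Proof.
move=> a0 vD va vs sn; pose g := restr D c.
have [t [t0 tT tC]] := topset_threshold s g.
pose T := topset s g; pose S := T :&: D.
have ST : (#|S| <= s)%N.
  by rewrite -[leqRHS](card_topset g sn) subset_leq_card// subsetIl.
pose u : 'cV[R]_n := \col_i (if i \in S then - a * Num.sg (c i 0) else 0).
have uE i : u i 0 = if i \in S then - a * Num.sg (c i 0) else 0.
  by rewrite mxE.
exists u, S; split=> //.
- exact: subsetIr.
- by move=> i /negPf iS; rewrite uE iS.
- rewrite norm2_sqr (@le_trans _ _ (\sum_(i in S) a ^+ 2))//.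
    rewrite [leRHS]big_mkcond; apply: ler_sum => i _; rewrite uE.
    case: ifP => _; last by rewrite expr0n.
    rewrite exprMn sqrrN sqr_sg ler_piMr ?sqr_ge0//.
    by case: (c i 0 != 0) => /=; rewrite ?ler01.
  by rewrite sumr_const mulr_natl ler_wpMn2l ?sqr_ge0.
have -> : dot c u = - (a * \sum_(i in T) `|g i 0|).
  rewrite mulr_sumr -sumrN [RHS]big_mkcond; apply: eq_bigr => i _.
  rewrite uE finset.in_setI restrE; case: (i \in T) => /=; last by rewrite mulr0.
  case: (i \in D); last by rewrite normr0 !mulr0 oppr0.
  by rewrite [in RHS]normrEsg; ring.
have vg i : - (`|g i 0| * `|v i 0|) <= c i 0 * v i 0.
  rewrite restrE; case: ifP => iD; last by rewrite vD ?iD// !normr0 !mulr0 oppr0.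
  by rewrite -normrM lerNl -normrN ler_norm.
apply: le_trans (_ : - \sum_i `|g i 0| * `|v i 0| <= _); last first.
  by rewrite -sumrN; apply: ler_sum.
rewrite lerN2 mulr_sumr.
have {}vs : t * \sum_i `|v i 0| <= \sum_(i in T) t * a.
  rewrite sumr_const card_topset// -mulr_natl mulrCA ler_wpM2l//.
rewrite (bigID (mem T))/=.
have h1 : \sum_(i | i \notin T) `|g i 0| * `|v i 0| <=
    \sum_(i | i \notin T) t * `|v i 0|.
  by apply: ler_sum => i iT; rewrite ler_wpM2r// tC.
have h2 : \sum_(i in T) `|g i 0| * `|v i 0| + \sum_(i in T) t * a
   <= \sum_(i in T) a * `|g i 0| + \sum_(i in T) t * `|v i 0|.
  rewrite -!big_split; apply: ler_sum => i iT /=.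
  by have := tT i iT; have := va i; rewrite -/T; nra.
move: vs; rewrite mulr_sumr (bigID (mem T))/=; lra.
Qed.

(** Cauchy-Schwarz against the indicator of S. *)
Lemma sum_abs_le_sqrt S x :
  \sum_(i in S) `|x i 0| <= Num.sqrt #|S|%:R * norm2 (restr S x).
Proof.
pose e : 'cV[R]_n := \col_i (i \in S)%:R.
pose y : 'cV[R]_n := \col_i `|restr S x i 0|.
have := cauchy_schwarz e y.
have -> : dot e y = \sum_(i in S) `|x i 0|.
  rewrite [RHS]big_mkcond; apply: eq_bigr => i _; rewrite !mxE.
  by case: ifP => _; rewrite ?mul1r ?mul0r.
have -> : norm2 e = Num.sqrt #|S|%:R.
  congr Num.sqrt; rewrite -sum1_card natr_sum [RHS]big_mkcond.
  apply: eq_bigr => i _; rewrite mxE.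
  by case: ifP; rewrite ?expr1n ?expr0n.
suff -> : norm2 y = norm2 (restr S x) by [].
congr Num.sqrt; apply: eq_bigr => i _.
by rewrite mxE real_normK// num_real.
Qed.

End TopSet.

(** * The cone condition and its consequences *)

Section Cone.
Context (R : realType) (n : nat).
Implicit Types (x h : 'cV[R]_n).

(** With S the r largest entries of xs and T0 the k largest of xt, comparing the
    masses outside S bounds the mass of h outside U = S :|: T0 by that on
    V = T0 :\: S plus twice the mass of xt outside T0.  As |U| + |V| is at most
    r + 2k, the masses of h on U and V add up to at most twice that on T. *)
Lemma partial_norm1_cone k r K (xs xt : 'cV[R]_n) :
  (r <= n)%N -> (K <= n)%N -> (2 * k + r <= 2 * K)%N ->
  partial_norm1 r xs <= partial_norm1 r xt ->
  \sum_(i | i \notin topset K (xt - xs)) `|(xt - xs) i 0| <=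
    \sum_(i in topset K (xt - xs)) `|(xt - xs) i 0|
    + 2 * norm1 (minus_max k xt).
Proof.
move=> rn Kn krK fst; set h := xt - xs; set T := topset K h.
pose S := topset r xs; pose T0 := topset k xt.
pose a i := `|h i 0|.
have Sr : (#|S| <= r)%N by rewrite card_topset_min geq_minl.
have T0k : (#|T0| <= k)%N by rewrite card_topset_min geq_minl.
have := le_trans fst (partial_norm1_le xt rn Sr).
rewrite partial_norm1E -/S norm1_minus_max -/T0 => fS.
pose U := S :|: T0; pose V := T0 :\: S.
have hUV : \sum_(i | i \notin U) a i <=
    \sum_(i in V) a i + 2 * \sum_(i | i \notin T0) `|xt i 0|.
  suff : \sum_(i | i \notin S) `|xt i 0| + \sum_(i | i \notin U) a i <=
    \sum_(i | i \notin S) `|xs i 0| +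
      (\sum_(i in V) a i + \sum_(i | i \notin T0) 2 * `|xt i 0|).
    by rewrite -mulr_sumr; lra.
  rewrite (big_mkcond (fun i => i \notin S)) (big_mkcond (fun i => i \notin U)).
  rewrite (big_mkcond (fun i => i \notin S)) (big_mkcond [in V]).
  rewrite (big_mkcond (fun i => i \notin T0)) -!big_split.
  apply: ler_sum => i _ /=.
  have hE : h i 0 = xt i 0 - xs i 0 by rewrite !mxE.
  have h1 : `|xt i 0| <= `|xs i 0| + a i.
    by rewrite /a hE addrC; have := lerB_dist (xt i 0) (xs i 0); lra.
  have h2 : a i <= `|xt i 0| + `|xs i 0|.
    by rewrite /a hE; exact: ler_normB.
  have h3 := normr_ge0 (xt i 0).
  rewrite finset.in_setU finset.in_setD.
  by case: (i \in S); case: (i \in T0) => /=; lra.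
have [t [t0 tT tC]] := topset_threshold K h.
have hU := threshold_sum U tT tC; have hV := threshold_sum V tT tC.
have hUVT : t * (#|U|%:R + #|V|%:R - 2 * K%:R) <= 0.
  rewrite mulr_ge0_le0// subr_le0 -natrD -natrM ler_nat.
  have := cardsUI S T0; have := cardsID S T0; rewrite -/U -/V finset.setIC.
  by lia.
have E (W : {set 'I_n}) : \sum_i a i =
    \sum_(i in W) a i + \sum_(i | i \notin W) a i.
  by rewrite (bigID [in W]).
move: hU hV; rewrite (card_topset _ Kn) -/T -!/(a _) => hU hV.
by have := E U; have := E T; rewrite -/T /a in hUV *; lra.
Qed.

Lemma norm2_split (S : {set 'I_n}) x :
  norm2 x ^+ 2 = norm2 (restr S x) ^+ 2 + \sum_(i | i \notin S) x i 0 ^+ 2.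
Proof. by rewrite norm2_sqr norm2_restr (bigID [in S]). Qed.

(** Every entry outside T is at most the least entry on T, hence at most
    Y / sqrt K; multiplied by the l1 mass of the tail this bounds its squared
    norm by Y (Y + P). *)
Lemma tail_estimates K h (P : R) : (0 < K <= n)%N ->
  let T := topset K h in let Y := norm2 (restr T h) in
  \sum_(i | i \notin T) `|h i 0| <=
    \sum_(i in T) `|h i 0| + Num.sqrt K%:R * P ->
  [/\ norm2 h ^+ 2 <= 2 * Y ^+ 2 + Y * P,
      norm1 h <= Num.sqrt K%:R * (2 * Y + P),
      forall i, i \notin T -> `|h i 0| <= Y / Num.sqrt K%:R &
      \sum_(i | i \notin T) `|h i 0| <= Num.sqrt K%:R * (Y + P)].
Proof.
move=> /andP[K0 Kn] T Y cone.
have q0 : 0 < Num.sqrt K%:R :> R by rewrite sqrtr_gt0 ltr0n.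
have Y0 : 0 <= Y by exact: norm2_ge0.
have hT := sum_abs_le_sqrt T h.
rewrite card_topset// -/Y in hT.
have {}cone : \sum_(i | i \notin T) `|h i 0| <= Num.sqrt K%:R * (Y + P) by lra.
have [t [t0 tT tC]] := topset_threshold K h.
have tY : Num.sqrt K%:R * t <= Y.
  rewrite -ler_sqr ?nnegrE ?mulr_ge0 ?sqrtr_ge0// exprMn sqr_sqrtr ?ler0n//.
  rewrite norm2_restr mulr_natl -[X in _ *+ X](card_topset h Kn) -sumr_const.
  apply: ler_sum => i iT; rewrite -[leRHS]real_normK ?num_real//.
  by rewrite ler_sqr ?nnegrE// tT.
split=> //.
- rewrite (norm2_split T) -/Y.
  suff : \sum_(i | i \notin T) h i 0 ^+ 2 <= Y ^+ 2 + Y * P by lra.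
  apply: (@le_trans _ _ (t * \sum_(i | i \notin T) `|h i 0|)).
    rewrite mulr_sumr; apply: ler_sum => i iT.
    by rewrite -real_normK ?num_real// expr2 ler_wpM2r// tC.
  apply: (le_trans (ler_wpM2l t0 cone)).
  have := le_trans (sumr_ge0 _ (fun i _ => normr_ge0 (h i 0))) cone.
  rewrite (pmulr_rge0 _ q0) => YP; rewrite mulrA -[Y ^+ 2]/(Y * Y) -mulrDr.
  by rewrite ler_wpM2r// mulrC.
- by rewrite /norm1 (bigID [in T])/=; lra.
- move=> i iT; rewrite ler_pdivlMr//; apply: le_trans tY.
  by rewrite mulrC ler_wpM2l ?tC// ltW.
Qed.

End Cone.

(** * A lower isometry bound for all vectors *)

Section Sampling.
Context (R : realType) (n : nat) (B : 'cV[R]_n -> 'cV[R]_n -> R).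
Context (BC : forall x y : 'cV[R]_n, B x y = B y x).
Context (BD : forall x y z : 'cV[R]_n, B (x + y) z = B x z + B y z).
Context (BZ : forall a (x y : 'cV[R]_n), B (a *: x) y = a * B x y).
Context (p : 'I_n -> R) (xi : 'I_n -> 'cV[R]_n) (k : nat).
Context (p_ge0 : forall i, 0 <= p i) (p_sum1 : \sum_i p i = 1).
Context (xi_supp : forall i, supported [set i] (xi i)).
Context (B_ge0 : forall (S : {set 'I_n}) x,
  supported S x -> (#|S| <= k)%N -> 0 <= B x x).
(* [v] is the mean of the random vector equal to [xi i] with probability [p i]. *)
Let v := \sum_i p i *: xi i.
Let Delta := \sum_i p i * B (xi i) (xi i).

Let BDr x y z : B x (y + z) = B x y + B x z.
Proof. by rewrite BC BD !(BC x). Qed.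

Let BZr a x y : B x (a *: y) = a * B x y.
Proof. by rewrite BC BZ (BC x). Qed.

Let mean z : \sum_i p i * B z (xi i) = B z v.
Proof.
rewrite /v; elim: (index_enum _) => [|i s IH].
  by rewrite !big_nil -(scale0r 0) BZr mul0r.
by rewrite !big_cons BDr BZr IH.
Qed.

(** The right-hand side is the expectation of B x x, where x is z plus t
    independent samples; every outcome is k-sparse, so it is nonnegative.  The
    induction conditions on the first sample. *)
Lemma sampling_nonneg t (S : {set 'I_n}) z : supported S z -> (#|S| + t <= k)%N ->
  0 <= B z z + 2 * t%:R * B z v + t%:R * Delta + t%:R * (t%:R - 1) * B v v.
Proof.
elim: t S z => [|t IH] S z zS Sk.
  have := B_ge0 zS; rewrite addn0 in Sk => /(_ Sk).
  by rewrite !(mulr0, mul0r) !addr0.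
have step i : 0 <= p i * (B (z + xi i) (z + xi i) + 2 * t%:R * B (z + xi i) v
    + t%:R * Delta + t%:R * (t%:R - 1) * B v v).
  rewrite mulr_ge0//; apply: (IH (i |: S)).
    apply: supportedD; first exact (supportedW (finset.subsetUr _ _) zS).
    exact (supportedW (finset.subsetUl _ _) (@xi_supp i)).
  rewrite (leq_trans _ Sk)// cardsU1 addnS -addSn leq_add2r.
  by case: (i \notin S).
have : 0 <= \sum_i p i * (B (z + xi i) (z + xi i) + 2 * t%:R * B (z + xi i) v
    + t%:R * Delta + t%:R * (t%:R - 1) * B v v) by exact: sumr_ge0.
under eq_bigr => i _.
  have -> : p i * (B (z + xi i) (z + xi i) + 2 * t%:R * B (z + xi i) v
    + t%:R * Delta + t%:R * (t%:R - 1) * B v v) =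
    p i * (B z z + 2 * t%:R * B z v + t%:R * Delta + t%:R * (t%:R - 1) * B v v)
    + 2 * (p i * B z (xi i)) + p i * B (xi i) (xi i)
    + 2 * t%:R * (p i * B v (xi i)).
    by rewrite !(BD, BDr) (BC (xi i) z) (BC (xi i) v); ring.
  over.
rewrite !big_split /= -mulr_suml p_sum1 -!mulr_sumr !mean -/Delta.
by rewrite -natr1; lra.
Qed.

(** The difference of two independent samples is 2-sparse, and the expected
    value of B on it is twice [Delta - B v v]. *)
Lemma variance_nonneg : (1 < k)%N -> B v v <= Delta.
Proof.
move=> k2.
have step i j : 0 <= p i * (p j * B (xi i - xi j) (xi i - xi j)).
  rewrite !mulr_ge0//; apply: (@B_ge0 [set i; j]); last first.
    by rewrite cards2; case: (i != j) => //; exact: ltnW.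
  apply: supportedD; first exact (supportedW (finset.subsetUl _ _) (@xi_supp i)).
  rewrite -scaleN1r; apply: supportedZ.
  exact (supportedW (finset.subsetUr _ _) (@xi_supp j)).
have : 0 <= \sum_i \sum_j p i * (p j * B (xi i - xi j) (xi i - xi j)).
  by apply: sumr_ge0 => i _; apply: sumr_ge0.
under eq_bigr => i _.
  rewrite -mulr_sumr; under eq_bigr => j _.
    have -> : p j * B (xi i - xi j) (xi i - xi j) =
      p j * B (xi i) (xi i) + (- 2) * (p j * B (xi i) (xi j))
      + p j * B (xi j) (xi j).
      by rewrite -scaleN1r !(BD, BDr, BZ, BZr) (BC (xi j) (xi i)); ring.
    over.
  rewrite !big_split /= -mulr_suml p_sum1 -mulr_sumr mean -/Delta mul1r.
  rewrite (_ : p i * _ = p i * B (xi i) (xi i) + (- 2) * (p i * B v (xi i))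
     + p i * Delta); last by rewrite (BC v); ring.
  over.
by rewrite !big_split /= -mulr_suml p_sum1 -mulr_sumr mean -/Delta; lra.
Qed.

End Sampling.

Section AllVectors.
Context (R : realType) (m n : nat) (A : 'M[R]_(m, n)).

(** Write x as the mean of random multiples, of modulus |x|_1, of signed basis
    vectors, the i-th one with probability |x_i| / |x|_1.  The forms
    C e = delta <.,.> + e B with e = 1 and e = -1 are nonnegative on k-sparse
    vectors: k samples give a lower bound for C 1 x x in terms of the
    diagonal term D1, and the variance bound for C (-1) controls D1. *)
Lemma rip_lower_l1 k delta (x : 'cV[R]_n) : rip A k delta -> (1 < k)%N ->
  (1 - delta) * norm2 x ^+ 2 <=
    norm2 (A *m x) ^+ 2 + 2 * delta / k%:R * norm1 x ^+ 2.
Proof.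
move=> ripA k2; set L := norm1 x.
have k0 : (0 : R) < k%:R by rewrite ltr0n; lia.
have L0 : 0 <= L by apply: sumr_ge0.
have [Le|Ln] := eqVneq L 0.
  have /psumr_eq0P xi : \sum_i `|x i 0| = 0 by exact: Le.
  have x0 : x = 0.
    apply/matrixP => i j; rewrite ord1 mxE; apply/eqP; rewrite -normr_eq0.
    by apply/eqP; apply: (xi (fun i _ => normr_ge0 (x i 0))).
  have n0 : norm2 (0 : 'cV[R]_n) ^+ 2 = 0.
    by rewrite norm2_sqr big1// => i _; rewrite mxE expr0n.
  by rewrite Le x0 n0 expr0n !mulr0 addr0 sqr_ge0.
have {}L0 : 0 < L by rewrite lt0r Ln.
case: (posnP n) => [n0|n0].
  by move: Ln; rewrite /L /norm1 big1 ?eqxx// => -[i hi] _; exfalso; move: hi; rewrite n0.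
have d0 : 0 <= delta by apply: rip_ge0 ripA _ n0; lia.
pose p i := `|x i 0| / L.
pose xi i : 'cV[R]_n := (L * Num.sg (x i 0)) *: delta_mx i 0.
have p0 i : 0 <= p i by rewrite divr_ge0// ltW.
have p1 : \sum_i p i = 1 by rewrite -mulr_suml -/L mulfV.
have xiS i : supported [set i] (xi i).
  by move=> j; rewrite inE !mxE => /negPf ->; rewrite mulr0.
have vE : \sum_i p i *: xi i = x.
  apply/matrixP => i j; rewrite ord1 summxE (bigD1 i)//= big1 ?addr0.
    rewrite !mxE !eqxx mulr1 mulrA mulfVK// [RHS]numEsg mulrC.
    by [].
  by move=> l /negPf li; rewrite !mxE eq_sym li !mulr0.
have dotxi : \sum_i p i * dot (xi i) (xi i) <= L ^+ 2.
  rewrite -[leRHS]mul1r -p1 mulr_suml; apply: ler_sum => i _.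
  rewrite ler_wpM2l// /dot (bigD1 i)//= big1 ?addr0.
    rewrite !mxE !eqxx mulr1 -expr2 exprMn sqr_sg ler_piMr ?sqr_ge0//.
    by case: (_ != _); rewrite ?ler01.
  by move=> l /negPf li; rewrite !mxE li mulr0 mul0r.
pose C e x y := delta * dot x y + e * defect A x y.
have CC e y z : C e y z = C e z y by rewrite /C dotC defectC.
have CD e y z t : C e (y + z) t = C e y t + C e z t.
  by rewrite /C dotDl defectDl; ring.
have CZ e a y z : C e (a *: y) z = a * C e y z.
  by rewrite /C dotZl defectZl; ring.
have C0 e : `|e| = 1 -> forall (S : {set 'I_n}) y,
    supported S y -> (#|S| <= k)%N -> 0 <= C e y y.
  move=> e1 S y yS Sk; have := rip_defect ripA yS Sk.
  rewrite -[`|defect A y y|]mul1r -e1 -normrM ler_norml => /andP[h _].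
  by rewrite /C -norm2_sqr_dot; lra.
have hp := @sampling_nonneg _ _ (C 1) (CC 1) (CD 1) (CZ 1) p xi k p0 p1 xiS
  (C0 1 (normr1 _)) k finset.set0 0 _ _.
have hm := @variance_nonneg _ _ (C (-1)) (CC (-1)) (CD (-1)) (CZ (-1)) p xi k
  p0 p1 xiS (C0 (-1) (normrN1 _)) k2.
have s0 : supported finset.set0 (0 : 'cV[R]_n) by move=> i _; rewrite mxE.
move: hp => /(_ s0); rewrite cards0 => /(_ (leqnn _)).
rewrite vE in hm *.
have C00 e y : C e 0 y = 0 by rewrite -(scale0r 0) CZ mul0r.
rewrite !C00 mulr0 !add0r => hp.
have hs : \sum_i p i * C 1 (xi i) (xi i) + \sum_i p i * C (-1) (xi i) (xi i)
   = 2 * delta * \sum_i p i * dot (xi i) (xi i).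
  rewrite mulr_sumr -big_split; apply: eq_bigr => i _; rewrite /C /=.
  by ring.
set D1 := \sum_i p i * C 1 _ _ in hs hp.
set D2 := \sum_i p i * C (-1) _ _ in hs hm.
have {}hp : 0 <= D1 + (k%:R - 1) * C 1 x x.
  by rewrite -(pmulr_rge0 _ k0) mulrDr mulrA.
have dd : 2 * delta * \sum_i p i * dot (xi i) (xi i) <= 2 * delta * L ^+ 2.
  by rewrite ler_wpM2l// mulr_ge0.
have dx := dot_ge0 x.
have hk : 0 <= k%:R * C 1 x x + 2 * delta * L ^+ 2.
  have dx' : 0 <= delta * dot x x by rewrite mulr_ge0.
  by move: hp hm hs dd; rewrite /C; lra.
have : 0 <= C 1 x x + 2 * delta / k%:R * L ^+ 2.
  rewrite -(pmulr_rge0 _ k0) mulrDr.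
  by rewrite (_ : _ * (_ / _ * _) = 2 * delta * L ^+ 2)//; field; rewrite gt_eqF.
rewrite /C defect_diag -norm2_sqr_dot; lra.
Qed.

End AllVectors.

(** * Cutting the head in two halves *)

Lemma sum_ord_shift k j a : (j <= k)%N ->
  (\sum_(s < k) ((a + s) %% k < j) = j)%N.
Proof.
case: k => [|k] jk; first by rewrite big_ord0; move: jk; rewrite leqn0 => /eqP.
pose b : 'I_k.+1 := inZp a.
under eq_bigr => s _.
  rewrite (_ : ((a + s) %% k.+1)%N = (b + s)%R :> nat); last first.
    by rewrite /= modnDml.
  over.
rewrite -(reindex_inj (addrI b) (P := xpredT)
  (F := fun s : 'I_k.+1 => (s < j)%N : nat)) /=.
rewrite -(big_mkord xpredT (fun s => (s < j)%N : nat)).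
rewrite (big_cat_nat (leq0n j) jk)//= (eq_big_nat _ _ (F2 := fun=> 1%N)).
  rewrite sum_nat_const_nat subn0 muln1 big_nat_cond big1 ?addn0// => i.
  by rewrite andbT => /andP[ji _]; rewrite ltnNge ji.
by move=> i /andP[_ ->].
Qed.

(** Cyclic windows of length j: a family of sets of size j in T covering each
    element of T equally often. *)
Lemma balanced_windows (n : nat) (T : {set 'I_n}) (j : nat) : (j <= #|T|)%N ->
  exists W : 'I_#|T| -> {set 'I_n}, [/\ forall s, W s \subset T,
    forall s, #|W s| = j &
    forall i, i \in T -> (\sum_s (i \in W s) = j)%N].
Proof.
move=> jT; pose pos i := index i (enum T).
exists (fun s => [set i in T | (pos i + s) %% #|T| < j]%N); split.
- by move=> s; apply/fintype.subsetP => i; rewrite inE => /andP[].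
- move=> s.
  transitivity (\sum_(i in T) (((pos i + s) %% #|T| < j) : nat))%N.
    rewrite -sum1_card big_mkcond [RHS]big_mkcond.
    by apply: eq_bigr => i _; rewrite inE; case: (i \in T); case: ltnP.
  rewrite -big_enum /=.
  case: (posnP #|T|) => [T0|T0].
    by exfalso; have := ltn_ord s; rewrite [X in (_ < X)%N]T0.
  have [i0 _] := card_gt0P T0.
  rewrite (big_nth i0) -cardE big_mkord -[RHS](sum_ord_shift s jT).
  apply: eq_bigr => i _; rewrite /pos index_uniq ?enum_uniq -?cardE//.
  by rewrite addnC.
- move=> i iT; rewrite -[RHS](sum_ord_shift (pos i) jT).
  by apply: eq_bigr => s _; rewrite inE iT.
Qed.

(** For odd k the term B(w, w) has coefficient 1 in [balanced_split_bound], so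
    B(w, v) may be a little smaller than in the even case when B(w, w) is
    large, but then B(w, w) itself makes up for it as long as P <= 3 Y.
    Beyond that the loss is at most delta P^2 / 16. *)
Lemma odd_order_arith (R : realType) (delta Y P G M k : R) :
  0 <= delta -> 0 < Y -> 0 <= P -> 3 <= k ->
  - (delta * Y ^+ 2) <= G -> G <= delta * Y ^+ 2 ->
  - (delta / 2) * ((k ^+ 2 + 1) * Y ^+ 2 + (k ^+ 2 - 1) * Y ^+ 2) <=
    1 * G + (k ^+ 2 - 1) / 2 * Y * M / (Y + P) ->
  - delta * (Y ^+ 2 + 2 * Y * (Y + P) + P ^+ 2 / 16) <= G + M.
Proof.
move=> d0 Y0 P0 k3 G1 G2 h.
have Q0 : 0 < Y + P by lra.
pose N := M / (Y + P).
have MN : M = N * (Y + P) by rewrite /N divfK// gt_eqF.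
have {}h : - (delta * k ^+ 2 * Y ^+ 2) <= G + (k ^+ 2 - 1) / 2 * (Y * N).
  by move: h; rewrite MN mulrA mulfK ?gt_eqF//; lra.
pose E := delta * Y ^+ 2 + G.
have E0 : 0 <= E by rewrite /E; lra.
have E2 : E <= 2 * delta * Y ^+ 2 by rewrite /E; lra.
have c8 : 8 <= k ^+ 2 - 1 by nra.
have {h G1 G2 N MN}hN : - (2 * delta * Y ^+ 2) - E / 4 <= Y * (M / (Y + P)).
  set t := Y * _; move: h; rewrite -/N -/t.
  rewrite (_ : G = E - delta * Y ^+ 2); last by rewrite /E; ring.
  move=> h; have h' : 0 <= E + (k ^+ 2 - 1) / 2 * (t + 2 * delta * Y ^+ 2) by lra.
  (* the coefficient (k^2 - 1) / 2 is at least 4 as k >= 3 *)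
  have [?|tneg] := lerP 0 (t + 2 * delta * Y ^+ 2); first by lra.
  by nra.
have MN : M = M / (Y + P) * (Y + P) by rewrite divfK// gt_eqF.
rewrite (_ : G = E - delta * Y ^+ 2); last by rewrite /E; ring.
rewrite MN; set N := M / _ in hN *.
rewrite -(ler_pM2l Y0).
have hQ : (- (2 * delta * Y ^+ 2) - E / 4) * (Y + P) <= Y * N * (Y + P).
  by rewrite ler_wpM2r// ltW.
suff : E * (P - 3 * Y) / 4 <= delta * Y * P ^+ 2 / 16 by move: hQ; lra.
have dY : 0 <= delta * Y by rewrite mulr_ge0// ltW.
have dYP : 0 <= delta * Y * (P ^+ 2 - 8 * Y * P + 24 * Y ^+ 2).
  by rewrite mulr_ge0//; have := sqr_ge0 (P - 4 * Y); have := sqr_ge0 Y; lra.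
(* the quadratic in dYP has negative discriminant *)
have [PY|PY] := lerP P (3 * Y).
  have h1 : E * (P - 3 * Y) <= 0 by rewrite mulr_ge0_le0// subr_le0.
  have h2 : 0 <= delta * Y * P ^+ 2 by rewrite mulr_ge0// sqr_ge0.
  by lra.
have : E * (P - 3 * Y) <= 2 * delta * Y ^+ 2 * (P - 3 * Y).
  by rewrite ler_wpM2r// subr_ge0 ltW.
by lra.
Qed.

Section Split.
Context (R : realType) (m n : nat) (A : 'M[R]_(m, n)).
Implicit Types (x y u v w : 'cV[R]_n).

Lemma norm2_disjointD (S : {set 'I_n}) x y :
  supported S x -> supported (~: S) y ->
  norm2 (x + y) ^+ 2 = norm2 x ^+ 2 + norm2 y ^+ 2.
Proof.
move=> xS yS; rewrite -[x in LHS]scale1r -[y in LHS]scale1r norm2_sqrD.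
by rewrite (dot_disjoint xS yS); ring.
Qed.

Lemma norm2Z a x : norm2 (a *: x) ^+ 2 = a ^+ 2 * norm2 x ^+ 2.
Proof. by rewrite !norm2_sqr_dot dotZl dotC dotZl; ring. Qed.

(** The average over the windows of the polarised inequality for the vectors
    k w_W and e w_W + c u, where w_W is w restricted to the window W and u is
    the l-sparse minimiser of B(w, .) on a polytope containing v.  Since
    j + l = k the two vectors share a support of size k. *)
Lemma window_average k delta (T : {set 'I_n}) w v (a e c : R) (j l : nat)
    (W : 'I_k -> {set 'I_n}) :
  rip A k delta -> (0 < j)%N -> (0 < l)%N -> (j + l = k)%N -> 0 <= delta ->
  supported T w -> supported (~: T) v -> 0 <= a -> 0 <= c ->
  (forall i, `|v i 0| <= a) -> \sum_i `|v i 0| <= k%:R * a -> (l <= n)%N ->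
  (forall s, W s \subset T) -> (forall s, (#|W s| <= j)%N) ->
  (forall i, i \in T -> (\sum_s (i \in W s) = j)%N) ->
  - (delta / 2) * ((k%:R ^+ 2 + e ^+ 2) * (j%:R * norm2 w ^+ 2)
     + k%:R * (c ^+ 2 * (k%:R ^+ 2 * a ^+ 2 / l%:R)))
  <= k%:R * e * \sum_s defect A (restr (W s) w) (restr (W s) w)
     + k%:R * c * (j%:R * defect A w v).
Proof.
move=> ripA j0 l0 jlk d0 wT vT a0 c0 va vs ln WT Wj Wc.
have l0R : (0 : R) < l%:R by rewrite ltr0n.
(* v also lies in the polytope of l-sparse vectors with entries up to b *)
pose b := k%:R * a / l%:R.
have ab : a <= b.
  by rewrite ler_pdivlMr// mulrC ler_wpM2r// ler_nat -jlk leq_addl.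
have b0 : 0 <= b by exact: le_trans ab.
have vb : \sum_i `|v i 0| <= l%:R * b.
  by apply: (le_trans vs); rewrite /b [leRHS]mulrC divfK ?gt_eqF.
have [u [S [ST Sl uS unorm uv]]] := sparse_linear_min (A^T *m (A *m w) - w) b0
  vT (fun i => le_trans (va i) ab) vb ln.
rewrite -!defectE in uv.
have {}unorm : norm2 u ^+ 2 <= k%:R ^+ 2 * a ^+ 2 / l%:R.
  apply: (le_trans unorm); rewrite le_eqVlt; apply/orP; left; apply/eqP.
  by rewrite /b; field; rewrite gt_eqF.
pose x s := restr (W s) w.
have xsum : \sum_s x s = j%:R *: w.
  apply/matrixP => i q; rewrite ord1 summxE mxE.
  have [iT|iT] := boolP (i \in T); last first.
    by rewrite wT// mulr0 big1// => s _; rewrite restrE wT// if_same.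
  rewrite -(Wc i iT) natr_sum mulr_suml; apply: eq_bigr => s _.
  by rewrite restrE; case: ifP => _; rewrite ?mul1r ?mul0r.
have xnorm : \sum_s norm2 (x s) ^+ 2 = j%:R * norm2 w ^+ 2.
  under eq_bigr => s _.
    rewrite norm2_sqr_dot (_ : dot _ _ = dot (x s) w); last first.
      rewrite !dot_restr; apply: eq_bigr => i iW.
      by rewrite restrE iW.
    over.
  by rewrite -dot_suml xsum dotZl norm2_sqr_dot.
have key s : - (delta / 2) * ((k%:R ^+ 2 + e ^+ 2) * norm2 (x s) ^+ 2
     + c ^+ 2 * norm2 u ^+ 2)
  <= k%:R * e * defect A (x s) (x s) + k%:R * c * defect A (x s) u.
  have xW : supported (W s) (x s) by exact: restr_supported.
  have WS : (#|W s :|: S| <= k)%N.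
    rewrite -jlk (leq_trans (leq_card_setU _ _))// leq_add//.
  have xWS := supportedW (finset.subsetUl (W s) S) xW.
  have uWS := supportedW (finset.subsetUr (W s) S) uS.
  have := rip_bilinear ripA (supportedZ k%:R xWS)
    (supportedD (supportedZ e xWS) (supportedZ c uWS)) WS.
  rewrite (norm2_disjointD (S := T)); last 2 first.
  - exact: supportedZ (supportedW (WT s) xW).
  - exact: supportedZ (supportedW ST uS).
  rewrite !norm2Z defectZl defectDr !defectZr; lra.
have : \sum_s (- (delta / 2) * ((k%:R ^+ 2 + e ^+ 2) * norm2 (x s) ^+ 2
     + c ^+ 2 * norm2 u ^+ 2)) <=
  \sum_s (k%:R * e * defect A (x s) (x s) + k%:R * c * defect A (x s) u).
  by apply: ler_sum => s _; exact: key.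
set Gs := \sum_s defect A (restr (W s) w) _.
have -> : \sum_s (k%:R * e * defect A (x s) (x s) + k%:R * c * defect A (x s) u)
    = k%:R * e * Gs + k%:R * c * (j%:R * defect A w u).
  by rewrite big_split /= -!mulr_sumr -defect_suml xsum defectZl.
rewrite -mulr_sumr big_split /= -mulr_sumr xnorm sumr_const card_ord -mulr_natl.
move=> h.
have h1 : k%:R * c * (j%:R * defect A w u) <= k%:R * c * (j%:R * defect A w v).
  by rewrite ler_wpM2l ?mulr_ge0// ler_wpM2l.
have h2 : delta / 2 * (k%:R * (c ^+ 2 * norm2 u ^+ 2)) <=
    delta / 2 * (k%:R * (c ^+ 2 * (k%:R ^+ 2 * a ^+ 2 / l%:R))).
  rewrite ler_wpM2l ?divr_ge0// ler_wpM2l// ler_wpM2l// sqr_ge0//.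
move: h; lra.
Qed.

(** Add the averages for the windows W with sign e and for their complements
    with sign - e, where e = j - l.  Since w_W + w_(T - W) = w, the quadratic
    terms combine: B(w_W, w_W) - B(w_(T - W), w_(T - W)) is
    B(w, w_W - w_(T - W)), whose sum over the windows is e B(w, w); so no
    diagonal entry of B survives. *)
Lemma balanced_split_bound k delta (T : {set 'I_n}) w v (a nu : R) (j l : nat) :
  rip A k delta -> (0 < j)%N -> (0 < l)%N -> (j + l = k)%N -> 0 <= delta ->
  #|T| = k -> supported T w -> supported (~: T) v -> 0 <= a -> 0 <= nu ->
  (forall i, `|v i 0| <= a) -> \sum_i `|v i 0| <= k%:R * a ->
  - (delta / 2) * ((k%:R ^+ 2 + (j%:R - l%:R) ^+ 2) * norm2 w ^+ 2
     + 4 * (j * l)%:R * nu ^+ 2 * (k%:R * a ^+ 2))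
  <= (j%:R - l%:R) ^+ 2 * defect A w w + 2 * (j * l)%:R * nu * defect A w v.
Proof.
move=> ripA j0 l0 jlk d0 Tk wT vT a0 nu0 va vs; set e : R := j%:R - l%:R.
have kn : (k <= n)%N by rewrite -Tk -[leqRHS]card_ord max_card.
have k0R : (0 : R) < k%:R by rewrite ltr0n; lia.
have j0R : (0 : R) < j%:R by rewrite ltr0n.
have l0R : (0 : R) < l%:R by rewrite ltr0n.
have jT : (j <= #|T|)%N by lia.
have [W [WT Wj Wc]] := balanced_windows jT.
move: W WT Wj Wc; rewrite Tk => W WT Wj Wc.
pose W' s := T :\: W s.
have W'T s : W' s \subset T by exact: subsetDl.
have W'l s : #|W' s| = l.
  have := cardsID (W s) T.
  by rewrite (finset.setIidPr (WT s)) Wj Tk -/(W' s); lia.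
have W'c i : i \in T -> (\sum_s (i \in W' s) = l)%N.
  move=> iT; apply/eqP; rewrite -(eqn_add2l j) -{1}(Wc i iT) -big_split /=.
  rewrite jlk; under eq_bigr => s _.
    rewrite (_ : (_ + _)%N = 1%N); last first.
      by rewrite finset.in_setD iT; case: (i \in W s).
    over.
  by rewrite sum1_card card_ord.
(* this scaling of u makes its squared norm comparable with that of w_W *)
pose c := 2 * (j * l)%:R * nu / k%:R.
have c0 : 0 <= c by rewrite divr_ge0// !mulr_ge0.
have ln : (l <= n)%N by lia.
have jn : (j <= n)%N by lia.
have ljk : (l + j = k)%N by rewrite addnC.
have h1 := window_average e ripA j0 l0 jlk d0 wT vT a0 c0 va vs ln WT
  (fun s => eq_leq (Wj s)) Wc.
have h2 := window_average (- e) ripA l0 j0 ljk d0 wT vT a0 c0 va vs jn W'T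
  (fun s => eq_leq (W'l s)) W'c.
have hd : \sum_s defect A (restr (W s) w) (restr (W s) w)
   - \sum_s defect A (restr (W' s) w) (restr (W' s) w) = e * defect A w w.
  rewrite -sumrB.
  have -> : e * defect A w w =
      defect A (\sum_s (restr (W s) w - restr (W' s) w)) w.
    rewrite -defectZl; congr defect; apply/matrixP => i q.
    rewrite ord1 mxE summxE.
    have [iT|iT] := boolP (i \in T); last first.
      by rewrite wT// mulr0 big1// => s _; rewrite !mxE wT// !if_same subr0.
    rewrite /e -{1}(Wc i iT) -(W'c i iT) !natr_sum -sumrB mulr_suml.
    apply: eq_bigr => s _; rewrite !mxE.
    by case: (i \in W s); case: (i \in W' s);
      rewrite ?subrr ?subr0 ?sub0r ?mul0r ?mul1r ?mulN1r.
  rewrite defect_suml; apply: eq_bigr => s _.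
  have {7}-> : w = restr (W s) w + restr (W' s) w.
    apply/matrixP => i q; rewrite ord1 !mxE finset.in_setD.
    have [iW|iW] := boolP (i \in W s); first by rewrite addr0.
    by have [iT|/wT->] := boolP (i \in T); rewrite add0r.
  rewrite -scaleN1r !(defectDl, defectDr, defectZl).
  by rewrite (defectC _ (restr (W' s) w) (restr (W s) w)); ring.
set s1 := \sum_s _ in h1 hd; set s2 := \sum_s _ in h2 hd.
have kE : k%:R = j%:R + l%:R :> R by rewrite -natrD jlk.
rewrite -(ler_pM2l k0R); move: (lerD h1 h2); congr (is_true (_ <= _)).
  by rewrite /c natrM kE; field; rewrite -kE !gt_eqF.
rewrite (_ : s1 = s2 + e * defect A w w); last by rewrite -hd; ring.
by rewrite /c natrM kE; field; rewrite -kE gt_eqF.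
Qed.

(** The optimal weight in [balanced_split_bound] is Y / (Y + P), with
    j and l the two halves of k. *)
Lemma head_defect_lower k delta (T : {set 'I_n}) w v (P : R) :
  rip A k delta -> (1 < k)%N -> #|T| = k -> 0 <= P ->
  supported T w -> supported (~: T) v ->
  (forall i, `|v i 0| <= norm2 w / Num.sqrt k%:R) ->
  \sum_i `|v i 0| <= Num.sqrt k%:R * (norm2 w + P) ->
  - delta * (norm2 w ^+ 2 + 2 * norm2 w * (norm2 w + P) + P ^+ 2 / 16)
  <= defect A w (w + v).
Proof.
move=> ripA k2 Tk P0 wT vT va vs.
have k0R : (0 : R) < k%:R by rewrite ltr0n; lia.
have q0 : 0 < Num.sqrt k%:R :> R by rewrite sqrtr_gt0.
have qq : Num.sqrt k%:R * Num.sqrt k%:R = k%:R :> R.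
  by rewrite -expr2 sqr_sqrtr// ltW.
have kn : (k <= n)%N by rewrite -Tk -[leqRHS]card_ord max_card.
have d0 : 0 <= delta by apply: rip_ge0 ripA _ _; lia.
set Y := norm2 w in va vs *; set q := Num.sqrt k%:R in q0 qq va vs.
have Y0 : 0 <= Y by exact: norm2_ge0.
have [Ye|Yn] := eqVneq Y 0.
  have w0 : w = 0.
    have /psumr_eq0P wi : \sum_i w i 0 ^+ 2 = 0.
      by rewrite -norm2_sqr -/Y Ye expr0n.
    apply/matrixP => i z; rewrite ord1 mxE; apply/eqP.
    by rewrite -sqrf_eq0 wi// => s _; exact: sqr_ge0.
  rewrite {1}w0 -(scale0r 0) defectZl mul0r Ye mulNr oppr_le0 mulr_ge0//.
  by rewrite expr0n mulr0 mul0r !add0r divr_ge0// sqr_ge0.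
have {Yn}Y1 : 0 < Y by rewrite lt0r Yn.
pose Q := Y + P; have Q0 : 0 < Q by rewrite /Q; lra.
pose a := Q / q.
have a0 : 0 <= a by rewrite divr_ge0// ltW.
have {}va i : `|v i 0| <= a.
  by apply: (le_trans (va i)); rewrite ler_wpM2r ?invr_ge0 ?(ltW q0)// /Q; lra.
have {}vs : \sum_i `|v i 0| <= k%:R * a.
  rewrite (le_trans vs)// /a -qq -/Q le_eqVlt; apply/orP; left; apply/eqP.
  by field; rewrite gt_eqF.
have ka : k%:R * a ^+ 2 = Q ^+ 2.
  by rewrite /a -qq; field; rewrite gt_eqF.
have jl : (uphalf k + k./2 = k)%N by rewrite uphalf_half -addnA addnn odd_double_half.
have l0 : (0 < k./2)%N by rewrite half_gt0.
have j0 : (0 < uphalf k)%N by rewrite uphalf_gt0; lia.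
have nu0 : 0 <= Y / Q by rewrite divr_ge0// ltW.
have := balanced_split_bound ripA j0 l0 jl d0 Tk wT vT a0 nu0 va vs.
have -> : (uphalf k)%:R - (k./2)%:R = (odd k)%:R :> R.
  by rewrite uphalf_half natrD addrK.
rewrite ka -/Y defectDr.
set G := defect A w w; set M := defect A w v.
have : `|G| <= delta * Y ^+ 2 by apply: (rip_defect ripA wT); rewrite Tk.
rewrite ler_norml => /andP[G1 G2].
have kE : k%:R = 2 * (k./2)%:R + (odd k)%:R :> R.
  by rewrite -[in LHS](odd_double_half k) natrD -muln2 natrM; ring.
have -> : (4 : R) * (uphalf k * k./2)%:R = k%:R ^+ 2 - (odd k)%:R ^+ 2.
  by rewrite uphalf_half natrM natrD kE; ring.
have -> : (2 : R) * (uphalf k * k./2)%:R = (k%:R ^+ 2 - (odd k)%:R ^+ 2) / 2.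
  by rewrite uphalf_half natrM natrD kE; field.
have -> (f : R) : f * (Y / Q) ^+ 2 * Q ^+ 2 = f * Y ^+ 2.
  by field; rewrite gt_eqF.
have -> (f : R) : f * (Y / Q) * M = f * Y * M / Q.
  by field; rewrite gt_eqF.
rewrite /Q in Q0 *.
have [ok|ek] := boolP (odd k).
  have k3 : (3 : R) <= k%:R.
    by rewrite ler_nat ltn_neqAle k2 andbT; apply: contraTneq ok => <-.
  by rewrite /= expr1n => h; apply: odd_order_arith k3 G1 G2 h.
rewrite /= expr0n subr0 addr0 mul0r add0r => h.
have : - (2 * delta * Y * (Y + P)) <= M.
  have c0 : 0 < k%:R ^+ 2 / 2 * Y / (Y + P).
    by rewrite !(mulr_gt0, invr_gt0, exprn_gt0).
  rewrite -(ler_pM2l c0); apply: le_trans (le_trans _ h) _.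
    rewrite le_eqVlt; apply/orP; left; apply/eqP.
    by field; rewrite gt_eqF.
  by rewrite le_eqVlt; apply/orP; left; apply/eqP; ring.
have : 0 <= delta * P ^+ 2 by rewrite mulr_ge0 ?sqr_ge0.
lra.
Qed.

End Split.

(** * From the quadratic inequalities to the error bounds *)

Section Arith.
Context (R : realType).

Lemma quadratic_bound (t B c : R) :
  0 <= B -> 0 <= c -> t ^+ 2 <= B * t + c ^+ 2 -> t <= B + c.
Proof. by move=> B0 c0 h; rewrite leNgt; apply/negP => lt; nra. Qed.

(** With D = 1 - 3 delta, q^2 = delta / D and u = 2 sigma sqrt(1 + delta) / D,
    the claim is H <= sqrt 2 Z for Z = u + (2 q^2 + q) P, while the third
    inequality for Y gives Y <= Z - (3/4) q P.  If q >= 1/3, this is at most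
    Z - P/4, which turns 2 Y^2 + Y P into at most 2 Z^2.  If q <= 1/3, the
    inequality with (1 - delta) H^2 gives the claim coefficient by coefficient
    in u^2, u P and P^2. *)
Lemma recovery_bound_third (delta sigma P Y H : R) :
  0 <= delta -> delta < 1 / 3 -> 0 <= sigma -> 0 <= P -> 0 <= Y -> 0 <= H ->
  H ^+ 2 <= 2 * Y ^+ 2 + Y * P ->
  (1 - delta) * H ^+ 2 <= 4 * sigma ^+ 2 + 2 * delta * (2 * Y + P) ^+ 2 ->
  (1 - 3 * delta) * Y ^+ 2 <= (2 * Num.sqrt (1 + delta) * sigma + 2 * delta * P) * Y
    + delta * P ^+ 2 / 16 ->
  H <= 2 * Num.sqrt (2 * (1 + delta)) * sigma / (1 - 3 * delta)
       + Num.sqrt 2 * (2 * delta + Num.sqrt ((1 - 3 * delta) * delta))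
           / (1 - 3 * delta) * P.
Proof.
move=> d0 d3 s0 P0 Y0 H0 H1 H2 Yq.
pose D := 1 - 3 * delta; have D0 : 0 < D by rewrite /D; lra.
pose g := Num.sqrt (D * delta); have g0 : 0 <= g by exact: sqrtr_ge0.
have gg : g ^+ 2 = D * delta by rewrite sqr_sqrtr// mulr_ge0// ltW.
pose t := 2 * Num.sqrt (1 + delta) * sigma.
have t0 : 0 <= t by rewrite !mulr_ge0// sqrtr_ge0.
have tt : 4 * sigma ^+ 2 <= t ^+ 2.
  rewrite /t !exprMn sqr_sqrtr ?addr_ge0//.
  by have := mulr_ge0 d0 (sqr_ge0 sigma); lra.
have DY : D * Y <= (t + 2 * delta * P) + g * P / 4.
  apply: quadratic_bound.
  - by rewrite addr_ge0// !mulr_ge0.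
  - by rewrite divr_ge0// mulr_ge0.
  - have := ler_wpM2l (ltW D0) Yq; rewrite -/D -/t => h.
    have -> : (g * P / 4) ^+ 2 = g ^+ 2 * P ^+ 2 / 16 by field.
    by rewrite gg; lra.
pose q := g / D; have q0 : 0 <= q by rewrite divr_ge0// ltW.
have gE : g = q * D by rewrite /q divfK// gt_eqF.
have dE : delta = q ^+ 2 * D.
  have : g ^+ 2 = D * delta by [].
  rewrite {1}gE => e; apply: (mulfI (lt0r_neq0 D0)); rewrite -e; ring.
have D1 : D * (1 + 3 * q ^+ 2) = 1.
  by have : D = 1 - 3 * delta by []; rewrite dE; lra.
pose u := t / D; have u0 : 0 <= u by rewrite divr_ge0// ltW.
have tE : t = u * D by rewrite /u divfK// gt_eqF.
pose Z := u + (2 * q ^+ 2 + q) * P.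
have YZ : Y <= u + (2 * q ^+ 2 + q / 4) * P.
  rewrite -(ler_pM2l D0); apply: (le_trans DY); rewrite gE tE dE.
  by rewrite le_eqVlt; apply/orP; left; apply/eqP; ring.
have Z0 : 0 <= Z.
  by rewrite addr_ge0// mulr_ge0// addr_ge0// mulr_ge0// sqr_ge0.
have -> : 2 * Num.sqrt (2 * (1 + delta)) * sigma / (1 - 3 * delta)
       + Num.sqrt 2 * (2 * delta + Num.sqrt ((1 - 3 * delta) * delta))
           / (1 - 3 * delta) * P = Num.sqrt 2 * Z.
  rewrite sqrtrM// -/D -/g /Z /u /t; set z := Num.sqrt (1 + delta).
  rewrite gE dE; field.
  by rewrite gt_eqF.
rewrite -(@ler_sqr _ H) ?nnegrE ?mulr_ge0 ?sqrtr_ge0// exprMn sqr_sqrtr//.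
have [q3|q3] := lerP 3^-1 q.
  have YZ' : Y <= Z - P / 4.
    by have : 0 <= (q - 3^-1) * P by [rewrite mulr_ge0// subr_ge0]; rewrite /Z; lra.
  by apply: (le_trans H1); nra.
have D_le1 : D <= 1 by rewrite /D; lra.
have qq : q ^+ 2 <= 3^-1 * q by rewrite expr2 ler_wpM2r// ltW.
have {}H2 : (1 + 2 * q ^+ 2) * H ^+ 2 <= u ^+ 2 + 2 * q ^+ 2 * (2 * Y + P) ^+ 2.
  rewrite -(ler_pM2l D0).
  have e1 : D * ((1 + 2 * q ^+ 2) * H ^+ 2) = (1 - delta) * H ^+ 2.
    by rewrite mulrA; congr (_ * _); rewrite dE; lra.
  rewrite e1; apply: (le_trans H2); have {}tt : 4 * sigma ^+ 2 <= D ^+ 2 * u ^+ 2.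
    by rewrite (le_trans tt)// tE exprMn mulrC.
  have h1 : D ^+ 2 * u ^+ 2 <= D * u ^+ 2.
    by rewrite ler_wpM2r ?sqr_ge0// expr2 ler_piMl// ltW.
  have h2 : 2 * delta * (2 * Y + P) ^+ 2 = D * (2 * q ^+ 2 * (2 * Y + P) ^+ 2).
    by rewrite dE; ring.
  by rewrite h2 mulrDr; move: tt h1; lra.
have c0 : 0 < 1 + 2 * q ^+ 2 by rewrite ltr_wpDr// mulr_ge0// sqr_ge0.
rewrite -(ler_pM2l c0); apply: (le_trans H2).
pose V := 2 * u + (1 + q / 2 + 4 * q ^+ 2) * P.
have YV : (2 * Y + P) ^+ 2 <= V ^+ 2.
  rewrite ler_sqr ?nnegrE//; first by rewrite /V; lra.
    by rewrite addr_ge0// mulr_ge0.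
  by have := mulr_ge0 q0 P0; have := mulr_ge0 (sqr_ge0 q) P0; rewrite /V; lra.
have : 2 * q ^+ 2 * (2 * Y + P) ^+ 2 <= 2 * q ^+ 2 * V ^+ 2.
  by rewrite ler_wpM2l// mulr_ge0// sqr_ge0.
suff : u ^+ 2 + 2 * q ^+ 2 * V ^+ 2 <= (1 + 2 * q ^+ 2) * (2 * Z ^+ 2) by lra.
have a1 : 2 * q ^+ 2 * (4 * u ^+ 2) <= u ^+ 2.
  by have := sqr_ge0 u; nra.
have a2 : 2 * q * (1 + q / 2 + 4 * q ^+ 2) <= 1 + 2 * q by nra.
have a3 : 1 + q / 2 + 4 * q ^+ 2 <= 1 + 2 * q by nra.
have b1 : q * (2 * q * (1 + q / 2 + 4 * q ^+ 2)) * (u * P) <=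
    q * (1 + 2 * q) * (u * P).
  by apply: ler_wpM2r; [rewrite mulr_ge0 | exact: ler_wpM2l].
have b2 : (1 + q / 2 + 4 * q ^+ 2) ^+ 2 * (q ^+ 2 * P ^+ 2) <=
    (1 + 2 * q) ^+ 2 * (q ^+ 2 * P ^+ 2).
  apply: ler_wpM2r; first by rewrite mulr_ge0 ?sqr_ge0.
  by have := sqr_ge0 q => q2; rewrite ler_sqr ?nnegrE//; lra.
have ZZ : Z ^+ 2 <= (1 + 2 * q ^+ 2) * Z ^+ 2.
  by rewrite ler_peMl ?sqr_ge0// lerDl mulr_ge0// sqr_ge0.
move: ZZ a1 b1 b2; rewrite /V /Z; lra.
Qed.

(** As s^2 = (gamma - 1) / gamma, the terms in X^2 on the left collapse to
    (s - delta) X^2; then solve the quadratic inequality for X and use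
    H <= sqrt 2 Y + P. *)
Lemma recovery_bound_gamma (gamma delta sigma P X Y H s : R) :
  0 <= delta -> 1 < gamma -> s = Num.sqrt ((gamma - 1) / gamma) -> delta < s ->
  0 <= sigma -> 0 <= P -> 0 <= Y -> 0 <= H -> Y <= X ->
  H ^+ 2 <= 2 * Y ^+ 2 + Y * P ->
  s * X ^+ 2 - delta / 2 * (X ^+ 2
     + s ^+ 2 * (X ^+ 2 + (X + P) ^+ 2 / (gamma - 1)))
    <= s * (2 * Num.sqrt (1 + delta) * sigma * X) ->
  H <= 2 * Num.sqrt (2 * (1 + delta)) * sigma
         / (1 - Num.sqrt (gamma / (gamma - 1)) * delta)
       + ((Num.sqrt 2 * delta
            + Num.sqrt (gamma * (s - delta) * delta))
            / (gamma * (s - delta)) + 1) * P.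
Proof.
move=> d0 g1 sE ds sg0 P0 Y0 H0 YX HY hX.
have g0 : 0 < gamma by lra.
have g1' : 0 < gamma - 1 by lra.
have s0 : 0 < s by rewrite sE sqrtr_gt0 divr_gt0.
have ss : s ^+ 2 = (gamma - 1) / gamma by rewrite sE sqr_sqrtr// divr_ge0// ltW.
pose e := s - delta; have e0 : 0 < e by rewrite /e; lra.
pose g := Num.sqrt (gamma * e * delta); have gge0 : 0 <= g by exact: sqrtr_ge0.
have gg : g ^+ 2 = gamma * e * delta.
  by rewrite sqr_sqrtr// mulr_ge0// mulr_ge0// ltW.
pose t := 2 * Num.sqrt (1 + delta) * sigma.
have t0 : 0 <= t by rewrite !mulr_ge0// sqrtr_ge0.
pose z : R := Num.sqrt 2; have z0 : 0 < z by rewrite sqrtr_gt0.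
have zz : z ^+ 2 = 2 by rewrite sqr_sqrtr.
have {}hX : e * X ^+ 2 <= (s * t + delta * P / gamma) * X
    + delta * P ^+ 2 / (2 * gamma).
  move: hX; rewrite -/t ss.
  have -> : (gamma - 1) / gamma * (X ^+ 2 + (X + P) ^+ 2 / (gamma - 1)) =
      X ^+ 2 + 2 * (X * P / gamma) + P ^+ 2 / gamma.
    by field; rewrite !gt_eqF.
  have -> : delta * P ^+ 2 / (2 * gamma) = delta / 2 * (P ^+ 2 / gamma).
    by field; rewrite gt_eqF.
  by rewrite /e; lra.
have eX : e * X <= (s * t + delta * P / gamma) + g * P / (z * gamma).
  apply: quadratic_bound.
  - apply: addr_ge0; first by rewrite mulr_ge0// ltW.
    by apply: divr_ge0; [rewrite mulr_ge0 | rewrite ltW].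
  - by apply: divr_ge0; [rewrite mulr_ge0 | rewrite ltW// mulr_gt0].
  - have := ler_wpM2l (ltW e0) hX.
    rewrite (_ : (g * P / (z * gamma)) ^+ 2 = e * (delta * P ^+ 2 / (2 * gamma))).
      by lra.
    by rewrite !exprMn exprVn exprMn gg zz; field; rewrite gt_eqF.
have HX : H <= z * X + P.
  have X0 : 0 <= X by exact: le_trans YX.
  have zX : 0 <= z * X by rewrite mulr_ge0// ltW.
  rewrite -ler_sqr ?nnegrE ?addr_ge0//; apply: (le_trans HY).
  rewrite sqrrD exprMn zz.
  have z1 : 1 <= z by rewrite -sqrtr1 ler_sqrt// ler1n.
  have := mulr_ge0 (mulr_ge0 X0 P0) (_ : 0 <= z - 1).
  rewrite subr_ge0 => /(_ z1).
  have := ler_wpM2r P0 YX; have := sqr_ge0 P.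
  have : Y ^+ 2 <= X ^+ 2 by rewrite ler_sqr.
  have := mulr_ge0 X0 P0; lra.
apply: (le_trans HX).
have -> : Num.sqrt (gamma / (gamma - 1)) = s^-1.
  by rewrite sE -sqrtrV ?invf_div// divr_ge0// ltW.
rewrite -/e -/g sqrtrM// -/z (mulrDl _ 1 P) mul1r addrA lerD2r.
rewrite -(ler_pM2l e0) mulrCA.
apply: le_trans (ler_wpM2l (ltW z0) eX) _.
rewrite le_eqVlt; apply/orP; left; apply/eqP.
have -> : 1 - s^-1 * delta = e / s by rewrite /e; field; rewrite gt_eqF.
rewrite /t; field.
by rewrite !gt_eqF.
Qed.

End Arith.

(** * Estimates for the two feasible vectors *)

Section Gamma.
Context (R : realType) (m n : nat) (A : 'M[R]_(m, n)).

(** Let t = N - K.  The tail has l1 mass at most t b, so at most t of its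
    entries exceed b; these join T to form T'.  What is left has sup norm at
    most b and l1 norm at most (t - |T1|) b, and may be replaced by a
    (t - |T1|)-sparse vector, of squared norm at most
    t b^2 <= (X + P)^2 / (gamma - 1).  The factor s on the second argument of
    the polarised inequality balances the two norms. *)
Lemma enlarged_head_defect_lower (K N : nat) (delta gamma s P : R) (T : {set 'I_n}) (h : 'cV[R]_n) :
  rip A N delta -> 0 <= delta -> (0 < K < N)%N -> (N <= n)%N -> #|T| = K ->
  1 < gamma -> K%:R * (gamma - 1) <= (N - K)%:R -> 0 <= P -> 0 <= s ->
  \sum_(i | i \notin T) `|h i 0| <= Num.sqrt K%:R * (norm2 (restr T h) + P) ->
  exists T' : {set 'I_n}, [/\ (#|T'| <= N)%N,
    norm2 (restr T h) <= norm2 (restr T' h) &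
    let X := norm2 (restr T' h) in
    - (delta / 2) * (X ^+ 2 + s ^+ 2 * (X ^+ 2 + (X + P) ^+ 2 / (gamma - 1)))
      <= s * defect A (restr T' h) h].
Proof.
move=> ripA d0 /andP[K0 KN] Nn TK g1 gK P0 s0 tail.
set Y := norm2 (restr T h) in tail *.
have Y0 : 0 <= Y by exact: norm2_ge0.
pose t := (N - K)%N; have t0 : (0 < t)%N by rewrite subn_gt0.
have t0R : (0 : R) < t%:R by rewrite ltr0n.
have q0 : 0 < Num.sqrt K%:R :> R by rewrite sqrtr_gt0 ltr0n.
have qq : Num.sqrt K%:R ^+ 2 = K%:R :> R by rewrite sqr_sqrtr.
pose b := Num.sqrt K%:R * (Y + P) / t%:R.
have b0 : 0 <= b by rewrite divr_ge0 ?mulr_ge0 ?addr_ge0// ltW.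
have tb : t%:R * b = Num.sqrt K%:R * (Y + P).
  by rewrite /b mulrC divfK// gt_eqF.
pose T1 := [set i | (i \notin T) && (b < `|h i 0|)].
have tail_split : \sum_(i | i \notin T) `|h i 0| =
    \sum_(i in T1) `|h i 0| + \sum_(i | i \notin T :|: T1) `|h i 0|.
  rewrite (bigID [in T1])/=; congr (_ + _); apply: eq_bigl => i.
    by rewrite inE; case: (i \in T).
  by rewrite finset.in_setU negb_or.
have rest0 : 0 <= \sum_(i | i \notin T :|: T1) `|h i 0| by apply: sumr_ge0.
have T1b : #|T1|%:R * b <= \sum_(i in T1) `|h i 0|.
  rewrite mulr_natl -sumr_const; apply: ler_sum => i.
  by rewrite inE => /andP[_ /ltW].
have T1t : (#|T1| <= t)%N.
  rewrite leqNgt; apply/negP => tT1.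
  have [i0 i0T] : exists i, i \in T1 by apply/card_gt0P; exact: leq_trans tT1.
  suff : #|T1|%:R * b < \sum_(i in T1) `|h i 0|.
    have : t%:R * b <= #|T1|%:R * b by rewrite ler_wpM2r// ler_nat ltnW.
    by rewrite tb; lra.
  rewrite mulr_natl -sumr_const (bigD1 i0)//= [ltRHS](bigD1 i0)//=.
  apply: ltr_leD; first by move: i0T; rewrite inE => /andP[].
  by apply: ler_sum => i; rewrite inE => /andP[/andP[_ /ltW]].
pose T' := T :|: T1; pose w := restr T' h; pose v := restr (~: T') h.
have T'K : (#|T'| <= K + #|T1|)%N by rewrite -TK leq_card_setU.
have vb i : `|v i 0| <= b.
  rewrite restrE finset.in_setC finset.in_setU negb_or inE.
  case: (i \in T) => /=; first by rewrite normr0.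
  by have [|] := lerP (`|h i 0|) b => //=; rewrite normr0.
have vs : \sum_i `|v i 0| <= (t - #|T1|)%:R * b.
  have -> : \sum_i `|v i 0| = \sum_(i | i \notin T') `|h i 0|.
    rewrite [RHS]big_mkcond; apply: eq_bigr => i _.
    by rewrite restrE finset.in_setC; case: (i \in T'); rewrite //= normr0.
  by rewrite natrB// mulrBl tb -/T'; lra.
have tn : (t - #|T1| <= n)%N by rewrite !(leq_trans (leq_subr _ _)).
have [u [S [ST Sl uS unorm uv]]] := sparse_linear_min (A^T *m (A *m w) - w) b0
  (@restr_supported _ _ (~: T') h) vb vs tn.
rewrite -!defectE in uv.
have wT' : supported T' w by exact: restr_supported.
have YX : Y ^+ 2 <= norm2 w ^+ 2.
  rewrite !norm2_restr (big_mkcond [in T]) (big_mkcond [in T']).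
  apply: ler_sum => i _; rewrite finset.in_setU.
  by case: (i \in T) => //=; case: ifP => // _; exact: sqr_ge0.
have {}YX : Y <= norm2 w by move: YX; rewrite ler_sqr ?nnegrE ?norm2_ge0.
have KtN : (K + t = N)%N by rewrite subnKC// ltnW.
exists T'; split=> //; first by rewrite (leq_trans T'K)// -KtN leq_add2l.
rewrite -/w /=; set X := norm2 w in YX *.
have X0 : 0 <= X by exact: norm2_ge0.
have WS : (#|T' :|: S| <= N)%N.
  rewrite (leq_trans (leq_card_setU _ _))//.
  by rewrite (leq_trans (leq_add T'K Sl))// -addnA subnKC// KtN.
have wWS := supportedW (finset.subsetUl T' S) wT'.
have uWS := supportedW (finset.subsetUr T' S) uS.
have := rip_bilinear ripA wWS (supportedZ s (supportedD wWS uWS)) WS.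
rewrite norm2Z (norm2_disjointD wT' (supportedW ST uS)) -/X.
rewrite defectZr defectDr => key.
have hE : defect A w h = defect A w w + defect A w v.
  by rewrite -defectDr restr_setC.
have g0 : 0 < gamma - 1 by lra.
have uX : norm2 u ^+ 2 <= (X + P) ^+ 2 / (gamma - 1).
  apply: (le_trans unorm).
  apply: (@le_trans _ _ (t%:R * b ^+ 2)).
    by rewrite ler_wpM2r ?sqr_ge0// ler_nat leq_subr.
  apply: (@le_trans _ _ ((Y + P) ^+ 2 / (gamma - 1))); last first.
    rewrite ler_wpM2r ?invr_ge0 ?(ltW g0)// ler_sqr ?nnegrE ?addr_ge0//.
    by rewrite lerD2r.
  rewrite ler_pdivlMr//.
  have -> : t%:R * b ^+ 2 * (gamma - 1) =
      (Y + P) ^+ 2 * (K%:R * (gamma - 1) / t%:R).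
    by rewrite -qq /b; field; rewrite gt_eqF.
  by rewrite ler_piMr ?sqr_ge0// ler_pdivrMr// mul1r.
have h1 : delta / 2 * (s ^+ 2 * norm2 u ^+ 2) <=
    delta / 2 * (s ^+ 2 * ((X + P) ^+ 2 / (gamma - 1))).
  by apply: ler_wpM2l; [rewrite divr_ge0 | rewrite ler_wpM2l ?sqr_ge0].
have h2 : s * defect A w u <= s * defect A w v by rewrite ler_wpM2l.
by rewrite hE; lra.
Qed.

Lemma norm2_image_feasible (b : 'cV[R]_m) (sigma : R) (x y : 'cV[R]_n) : 0 <= sigma ->
  norm2 (A *m x - b) <= sigma -> norm2 (A *m y - b) <= sigma ->
  norm2 (A *m (x - y)) <= 2 * sigma.
Proof.
move=> s0 xs ys.
have -> : A *m (x - y) = 1 *: (A *m x - b) + (-1) *: (A *m y - b).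
  by rewrite mulmxBr scale1r scaleN1r opprB addrA subrK.
move: xs ys; set p := _ - b; set q := _ - b => ps qs.
rewrite -ler_sqr ?nnegrE ?norm2_ge0 ?mulr_ge0//.
have := sqr_ge0 (norm2 (1 *: p + 1 *: q)).
have p2 : norm2 p ^+ 2 <= sigma ^+ 2 by rewrite ler_sqr ?nnegrE ?norm2_ge0.
have q2 : norm2 q ^+ 2 <= sigma ^+ 2 by rewrite ler_sqr ?nnegrE ?norm2_ge0.
by rewrite !norm2_sqrD; move: p2 q2; lra.
Qed.

Lemma dot_image_le k delta (S : {set 'I_n}) (x h : 'cV[R]_n) (sigma : R) :
  rip A k delta -> (#|S| <= k)%N -> 0 <= 1 + delta ->
  norm2 (A *m h) <= 2 * sigma ->
  dot (A *m restr S x) (A *m h) <=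
    2 * Num.sqrt (1 + delta) * sigma * norm2 (restr S x).
Proof.
move=> ripA Sk d0 hs; apply: le_trans (cauchy_schwarz _ _) _.
have Ax : norm2 (A *m restr S x) <= Num.sqrt (1 + delta) * norm2 (restr S x).
  rewrite -ler_sqr ?nnegrE ?norm2_ge0 ?mulr_ge0 ?sqrtr_ge0 ?norm2_ge0//.
  rewrite exprMn (sqr_sqrtr d0).
  by have /andP[] := ripA _ (supported_sparse (@restr_supported _ _ S x) Sk).
apply: (@le_trans _ _ (Num.sqrt (1 + delta) * norm2 (restr S x) * (2 * sigma))).
  by apply: ler_pM; rewrite ?norm2_ge0.
by rewrite le_eqVlt; apply/orP; left; apply/eqP; ring.
Qed.

End Gamma.

Unset Implicit Arguments.

Theorem theorem4p10 (R : realType) (m n : nat) (A : 'M[R]_(m, n))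
    (b : 'cV[R]_m) (sigma : R) (sigma_ge0 : 0 <= sigma)
    (k r : nat) (k_ge2 : (2 <= k)%N) (kr_le : (k + r <= n - 1)%N)
    (xs xt : 'cV[R]_n)
    (xs_opt : minimizer (partial_norm1 r) (feasible A b sigma) xs)
    (xt_feas : norm2 (A *m xt - b) <= sigma) :
  (forall delta : R,
     delta = ric A (k + uphalf r) ->
     delta < 1 / 3 ->
     norm2 (xt - xs) <=
       2 * Num.sqrt (2 * (1 + delta)) * sigma / (1 - 3 * delta)
       + 2 * Num.sqrt 2 * (2 * delta + Num.sqrt ((1 - 3 * delta) * delta))
           / (1 - 3 * delta)
         * (norm1 (minus_max k xt) / Num.sqrt (k + uphalf r)%:R))
  /\
  (forall gamma delta : R,
     1 < gamma ->
     (* the order of the restricted isometry constant is at most n *)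
     Num.ceil (gamma * (k + uphalf r)%:R) <= n%:Z ->
     delta = ric_real A (gamma * (k + uphalf r)%:R) ->
     delta < Num.sqrt ((gamma - 1) / gamma) ->
     norm2 (xt - xs) <=
       2 * Num.sqrt (2 * (1 + delta)) * sigma
         / (1 - Num.sqrt (gamma / (gamma - 1)) * delta)
       + ((Num.sqrt 2 * delta
            + Num.sqrt (gamma * (Num.sqrt ((gamma - 1) / gamma) - delta) * delta))
            / (gamma * (Num.sqrt ((gamma - 1) / gamma) - delta))
          + 1)
         * (2 * norm1 (minus_max k xt) / Num.sqrt (k + uphalf r)%:R)).
Proof.
case: xs_opt => xs_feas xs_min.
set K := (k + uphalf r)%N; set h := xt - xs.
have r2 : (r <= 2 * uphalf r)%N.
  by rewrite -[in leqLHS](odd_double_half r) uphalf_half; lia.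
have ur : (uphalf r <= r)%N by rewrite leq_uphalf_double; lia.
have K2 : (1 < K)%N by rewrite /K; lia.
have Kn : (K < n)%N by rewrite /K; lia.
have [rn krK] : (r <= n)%N /\ (2 * k + r <= 2 * K)%N by rewrite /K; lia.
have K0 : (0 < K)%N := ltnW K2.
have n0 : (0 < n)%N := leq_ltn_trans (leq0n K) Kn.
have KK : (0 < K <= n)%N by rewrite K0 ltnW.
pose q : R := Num.sqrt K%:R.
have q0 : 0 < q by rewrite sqrtr_gt0 ltr0n.
have qq : q ^+ 2 = K%:R by rewrite sqr_sqrtr.
pose P := 2 * norm1 (minus_max k xt) / q.
have P0 : 0 <= P.
  by rewrite divr_ge0 ?mulr_ge0 ?(ltW q0)// sumr_ge0.
pose T := topset K h; have TK : #|T| = K by rewrite card_topset// ltnW.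
pose w := restr T h; pose v := restr (~: T) h; pose Y := norm2 w.
have Y0 : 0 <= Y by exact: norm2_ge0.
have H0 : 0 <= norm2 h by exact: norm2_ge0.
have cone : \sum_(i | i \notin T) `|h i 0| <=
    \sum_(i in T) `|h i 0| + q * P.
  rewrite /P mulrC divfK ?gt_eqF//.
  by apply: (partial_norm1_cone rn (ltnW Kn) krK); exact: xs_min.
have [HY h1 hY htail] := tail_estimates KK cone.
rewrite -/T -/w -/Y -/q in HY h1 hY htail.
have Ah : norm2 (A *m h) <= 2 * sigma by exact: norm2_image_feasible sigma_ge0 xt_feas xs_feas.
split.
- move=> delta dE d3.
  have ripA : rip A K delta by rewrite dE; exact: (ric_smallest A KK).1.
  have d0 : 0 <= delta := rip_ge0 ripA K0 n0.
  have est : - delta * (Y ^+ 2 + 2 * Y * (Y + P) + P ^+ 2 / 16) <=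
      defect A w (w + v).
    apply: head_defect_lower ripA K2 TK P0 (@restr_supported _ _ T h)
      (@restr_supported _ _ (~: T) h) _ _ => [i|].
      rewrite restrE finset.in_setC; case: ifP => iT; first exact: hY.
      by rewrite normr0 divr_ge0// ltW.
    rewrite (_ : \sum_i _ = \sum_(i | i \notin T) `|h i 0|)//.
    rewrite [RHS]big_mkcond; apply: eq_bigr => i _.
    by rewrite restrE finset.in_setC; case: ifP => _; rewrite ?normr0.
  have up := dot_image_le (S := T) h ripA (eq_leq TK) (addr_ge0 ler01 d0) Ah.
  rewrite restr_setC /defect (_ : dot w h = Y ^+ 2) in est; last first.
    by rewrite -/(norm2 w) norm2_restr dot_restr.
  have low := rip_lower_l1 h ripA K2.
  have -> : 2 * Num.sqrt 2 * (2 * delta + Num.sqrt ((1 - 3 * delta) * delta))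
           / (1 - 3 * delta) * (norm1 (minus_max k xt) / Num.sqrt K%:R) =
     Num.sqrt 2 * (2 * delta + Num.sqrt ((1 - 3 * delta) * delta))
           / (1 - 3 * delta) * P by rewrite /P -/q; ring.
  apply: (recovery_bound_third d0 d3 sigma_ge0 P0 Y0 H0 HY).
    apply: (le_trans low).
    have s2 : norm2 (A *m h) ^+ 2 <= 4 * sigma ^+ 2.
      rewrite (_ : 4 * sigma ^+ 2 = (2 * sigma) ^+ 2); last by ring.
      by rewrite ler_sqr ?nnegrE ?norm2_ge0 ?mulr_ge0.
    apply: lerD s2 _.
    have n1 : norm1 h ^+ 2 <= (q * (2 * Y + P)) ^+ 2.
      rewrite ler_sqr ?nnegrE ?sumr_ge0//.
      by rewrite mulr_ge0 ?(ltW q0)// addr_ge0// mulr_ge0.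
    apply: le_trans (ler_wpM2l _ n1) _.
      by rewrite divr_ge0 ?mulr_ge0.
    rewrite exprMn qq mulrA divfK//.
    by rewrite pnatr_eq0 -lt0n.
  by move: est up; rewrite -/w -/Y; lra.
- move=> gamma delta g1 gn dE ds.
  set s := Num.sqrt ((gamma - 1) / gamma) in ds *.
  pose N := `|Num.ceil (gamma * K%:R)|%N.
  have K0R : (0 : R) < K%:R by rewrite ltr0n.
  have gK0 : 0 < gamma * K%:R by rewrite mulr_gt0// (lt_trans ltr01).
  have NE : N%:Z = Num.ceil (gamma * K%:R).
    by rewrite /N gez0_abs// ceil_ge0 (lt_trans _ gK0) ?ltrN10.
  have gN : gamma * K%:R <= N%:R.
    by have := ceil_ge (gamma * K%:R); rewrite -NE.
  have KN : (K < N)%N.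
    rewrite -(ltr_nat R); apply: lt_le_trans gN.
    by rewrite ltr_pMl.
  have Nn : (N <= n)%N by rewrite -lez_nat NE.
  have N0 : (0 < N)%N := ltn_trans K0 KN.
  have N0n : (0 < N <= n)%N by rewrite Nn N0.
  have ripA : rip A N delta by rewrite dE; exact: (ric_smallest A N0n).1.
  have d0 : 0 <= delta := rip_ge0 ripA N0 n0.
  have KN' : (0 < K < N)%N by rewrite K0 KN.
  have gK : K%:R * (gamma - 1) <= (N - K)%:R.
    by rewrite natrB ?(ltnW KN)//; lra.
  have s0 : 0 <= s by exact: sqrtr_ge0.
  have [T' [T'N YX est]] := enlarged_head_defect_lower ripA d0 KN' Nn TK g1 gK P0 s0 htail.
  have up := dot_image_le (S := T') h ripA T'N (addr_ge0 ler01 d0) Ah.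
  apply: (recovery_bound_gamma d0 g1 erefl ds sigma_ge0 P0 Y0 H0 YX HY).
  rewrite /= /defect (_ : dot (restr T' h) h = norm2 (restr T' h) ^+ 2) in est;
    last by rewrite norm2_restr dot_restr.
  have := ler_wpM2l s0 up; move: est; rewrite -/s; lra.
Qed.
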